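(* For every constant $K>0$ there exists $\eta_0>0$ such that for every $0<\eta\le\eta_0$ there exists $n_0$ such that the following holds for all $n\ge n_0$. Let $G$ be an oriented graph on $n$ vertices such that $\deg^+(x)+\deg^-(y)\ge (3n-3)/4$ for all distinct $x,y\in V(G)$ with $xy\notin E(G)$. Then at least one of the following holds: (i) $G$ contains a (directed) Hamilton cycle; (ii) $G$ is $\eta$-extremal (with implied constant $K$).
   Context: An oriented graph is a finite digraph without loops in which there is at most one arc between any two vertices. $xy$ denotes the edge directed from $x$ to $y$; $\deg^+(v)$, $\deg^-(v)$ are the outdegree and indegree of $v$. Cycles are directed. For vertex sets $X,Y$, $e(X,Y)$ is the number of edges $xy$ with $x\in X$, $y\in Y$, and $e(X)$ is the number of edges with both ends in $X$. Definition. Given $K,\eta>0$, an oriented graph $G$ on $n$ vertices is $\eta$-extremal (with implied constant $K$) if there are pairwise disjoint vertex subsets $A,B,C,D\subset V(G)$ (where $A$ or $C$ may be empty) such that $\big||A|+|C|-n/2\big|\le K\eta n$, $\big||B|-n/4\big|\le K\eta n$, $\big||D|-n/4\big|\le K\eta n$, and $e(A,B)>|A||B|-K\eta n^2$, $e(B,C)>|B||C|-K\eta n^2$, $e(C,D)>|C||D|-K\eta n^2$, $e(D,A)>|A||D|-K\eta n^2$, $e(B,D)>|A|n/8-K\eta n^2$, $e(D,B)>|C|n/8-K\eta n^2$, $e(A)>|A|^2/2-K\eta n^2$, $e(C)>|C|^2/2-K\eta n^2$, $e(A,C)<K\eta n^2$, $e(D)<K\eta n^2$. *)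

(* Defs.v *)
From HB Require Import structures.
From mathcomp Require Import all_boot all_order all_algebra.
From mathcomp Require Import reals.

Set Implicit Arguments.
Unset Strict Implicit.
Unset Printing Implicit Defensive.

Import Order.TTheory GRing.Theory Num.Theory.
Local Open Scope ring_scope.

(* A finite digraph is given by its arc relation [e : rel V] on a finite
   type of vertices: [e x y] means that there is an arc from x to y. *)

Definition oriented_graph (V : finType) (e : rel V) : Prop :=
  irreflexive e /\ (forall x y : V, x != y -> ~~ (e x y && e y x)).

Definition outdeg (V : finType) (e : rel V) (v : V) : nat :=
  #|[set w | e v w]|.

Definition indeg (V : finType) (e : rel V) (v : V) : nat :=
  #|[set u | e u v]|.

Definition edges_between (V : finType) (e : rel V) (X Y : {set V}) : nat :=
  #|[set p : V * V | [&& p.1 \in X, p.2 \in Y & e p.1 p.2]]|.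

Definition edges_within (V : finType) (e : rel V) (X : {set V}) : nat :=
  #|[set p : V * V | [&& p.1 \in X, p.2 \in X & e p.1 p.2]]|.

(* [cycle e [::]] holds vacuously, hence the nonemptiness condition; in an
   oriented graph cycles of length 1 and 2 are excluded by [cycle e s]. *)
Definition hamiltonian (V : finType) (e : rel V) : Prop :=
  exists s : seq V,
    [/\ s != [::], cycle e s, uniq s & forall x : V, x \in s].

Record extremal_sets (R : realType) (K eta : R) (V : finType) (e : rel V)
    (A B C D : {set V}) : Prop := ExtremalSets {
  ext_disjAB : [disjoint A & B];
  ext_disjAC : [disjoint A & C];
  ext_disjAD : [disjoint A & D];
  ext_disjBC : [disjoint B & C];
  ext_disjBD : [disjoint B & D];
  ext_disjCD : [disjoint C & D];
  ext_cardAC :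
    `|#|A|%:R + #|C|%:R - #|V|%:R / 2| <= K * eta * #|V|%:R;
  ext_cardB : `|#|B|%:R - #|V|%:R / 4| <= K * eta * #|V|%:R;
  ext_cardD : `|#|D|%:R - #|V|%:R / 4| <= K * eta * #|V|%:R;
  ext_AB : (edges_between e A B)%:R
             > #|A|%:R * #|B|%:R - K * eta * #|V|%:R ^+ 2;
  ext_BC : (edges_between e B C)%:R
             > #|B|%:R * #|C|%:R - K * eta * #|V|%:R ^+ 2;
  ext_CD : (edges_between e C D)%:R
             > #|C|%:R * #|D|%:R - K * eta * #|V|%:R ^+ 2;
  ext_DA : (edges_between e D A)%:R
             > #|A|%:R * #|D|%:R - K * eta * #|V|%:R ^+ 2;
  ext_BD : (edges_between e B D)%:R
             > #|A|%:R * #|V|%:R / 8 - K * eta * #|V|%:R ^+ 2;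
  ext_DB : (edges_between e D B)%:R
             > #|C|%:R * #|V|%:R / 8 - K * eta * #|V|%:R ^+ 2;
  ext_A : (edges_within e A)%:R
             > #|A|%:R ^+ 2 / 2 - K * eta * #|V|%:R ^+ 2;
  ext_C : (edges_within e C)%:R
             > #|C|%:R ^+ 2 / 2 - K * eta * #|V|%:R ^+ 2;
  ext_AC : (edges_between e A C)%:R < K * eta * #|V|%:R ^+ 2;
  ext_D : (edges_within e D)%:R < K * eta * #|V|%:R ^+ 2
}.

Definition extremal (R : realType) (K eta : R) (V : finType) (e : rel V) :
    Prop :=
  exists A B C D : {set V}, extremal_sets K eta e A B C D.

(* Main.v *)
(** Say that a digraph expands if any two sets [S], [T], neither too small,
    with [#|S| + #|T| >= (1 - 1/q) n] span at least [n^2 / q] arcs from [S]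
    to [T].  If the Ore condition holds and [S], [T] violate expansion, averaging the
    condition over pairs from the parts [A = S \ T], [B] (outside), [C = T \ S] and
    [D = S & T] is tight, which forces the extremal structure.

    An expander with linear degrees is hamiltonian by absorption, without
    regularity.  Expansion, also of alternating walks or of arcs composed with a
    permutation, yields a positive proportion of all walks of a fixed length between
    any two vertices.  An alternating walk [y -> b1 <- a1 -> b2 <- ... <- at -> x] with
    [t] odd gives arcs [ai -> bi] such that any path from [x] to [y] can be inserted
    in a path traversing them in this order.  A potential argument picks few disjoint alternating walks
    serving every pair [(x, y)] many times; they are linked into a cycle.  The
    remaining vertices are covered by few paths: among the permutations with all
    cycles of length at least [L], one with the fewest non-arcs has at most [2 L] of
    them, for otherwise rerouting along a walk through far apart points removes a
    non-arc without creating a short cycle.  These paths are then absorbed. *)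
Require Import Defs.
From mathcomp Require Import all_boot all_order all_algebra.
From mathcomp Require Import fingroup perm path fingraph reals.
From mathcomp Require Import zify ring lra.

Set Implicit Arguments.
Unset Strict Implicit.
Unset Printing Implicit Defensive.

Import Order.TTheory GRing.Theory Num.Theory.
Local Open Scope nat_scope.

(** * Expansion and arc counts *)

(** Denominators are cleared so that everything stays in [nat]. The parameters are kept apart
    because deleting few vertices turns [expander 8 16 q] into [expander 9 12 (2 * q)]. *)
Definition expander (V : finType) (d k q : nat) (E : rel V) : Prop :=
  [/\ forall x, #|V| <= d * outdeg E x,
      forall x, #|V| <= d * indeg E x
    & forall S T : {set V}, #|V| <= k * #|S| -> #|V| <= k * #|T| ->
        q * #|V| <= q * (#|S| + #|T|) + #|V| ->
        #|V| ^ 2 <= q * edges_between E S T].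

Lemma edges_between_suml (V : finType) (E : rel V) (S T : {set V}) :
  edges_between E S T = \sum_(x in S) #|[set y in T | E x y]|.
Proof.
rewrite /edges_between -sum1dep_card.
rewrite (eq_bigl (fun p => (p.1 \in S) && ((p.2 \in T) && E p.1 p.2))); last first.
  by move=> p; rewrite !andbA.
rewrite -(pair_big_dep (mem S) (fun x y => (y \in T) && E x y) (fun _ _ => 1)) /=.
by apply: eq_bigr => x _; rewrite sum1dep_card.
Qed.

Definition transp (V : Type) (E : rel V) : rel V := fun x y => E y x.

Lemma edges_between_transp (V : finType) (E : rel V) (S T : {set V}) :
  edges_between (transp E) S T = edges_between E T S.
Proof.
pose sw (p : V * V) := (p.2, p.1).
have sw_inj : injective sw by move=> [a b] [c d] [-> ->].
rewrite /edges_between -(card_imset _ sw_inj).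
apply: eq_card => -[x y]; rewrite !inE /=; apply/imsetP/idP => /=.
  by case=> -[a b]; rewrite !inE /= => /and3P[? ? ?] [-> ->]; apply/and3P.
by move=> /and3P[? ? ?]; exists (y, x) => //; rewrite !inE; apply/and3P.
Qed.

Lemma edges_between_sumr (V : finType) (E : rel V) (S T : {set V}) :
  edges_between E S T = \sum_(y in T) #|[set x in S | E x y]|.
Proof. by rewrite -edges_between_transp edges_between_suml. Qed.

Lemma expander_transp (V : finType) (d k q : nat) (E : rel V) :
  expander d k q E -> expander d k q (transp E).
Proof.
move=> [Ho Hi HE]; split=> // S T hS hT hST.
by rewrite edges_between_transp; apply: HE => //; rewrite [#|T| + _]addnC.
Qed.

(** * Counting walks in expanders *)

Section Walks.
Variables (V : finType) (E : nat -> rel V).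
Implicit Types (s : seq V) (x y v : V) (Z : {set V}).

(** The relation may depend on the position, so that one count covers ordinary walks, alternating
    walks and walks twisted by a permutation. *)
Fixpoint gwalk i x s y : bool :=
  if s is v :: s' then E i x v && gwalk i.+1 v s' y else E i x y.

(** Each chosen [v] forbids [B v] to later vertices: [[set v]] gives distinct vertices outside [Z],
    a window along a permutation gives points far apart. *)
Fixpoint spread (B : V -> {set V}) Z s : bool :=
  if s is v :: s' then (v \notin Z) && spread B (Z :|: B v) s' else true.

(* [rich q y k i v] makes a walk of [k] inner vertices from [v] to [y] extendable
   greedily: every partial walk has at least [#|V| / (2 q)] rich continuations. *)
Fixpoint rich q y k i v : bool :=
  if k is k'.+1 then #|V| <= 2 * q * #|[set u | E i v u & rich q y k' i.+1 u]|
  else E i v y.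

Lemma card_tuple_cons k (P : V -> pred (seq V)) :
  #|[set s : k.+1.-tuple V | if val s is v :: s' then P v s' else false]|
  = \sum_v #|[set s : k.-tuple V | P v s]|.
Proof.
under eq_bigr => v _ do rewrite -sum1dep_card.
rewrite pair_big_dep /= -sum1dep_card.
rewrite (reindex (fun p : V * k.-tuple V => [tuple of p.1 :: p.2])) //=.
exists (fun s : k.+1.-tuple V => (thead s, [tuple of behead s])).
  by move=> [v s] _ /=; rewrite theadE; congr pair; apply: val_inj.
by move=> s _; rewrite /= -tuple_eta.
Qed.

(** Of the [|V| / (2q)] rich continuations at least half avoid the forbidden vertices, whose number
    stays at most [|V| / (4q)]; so each step multiplies the count by at least [|V| / (4q)]. *)
Lemma rich_count q y (B : V -> {set V}) L k i v Z :
  (forall u, #|B u| <= L) -> rich q y k i v ->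
  4 * q * (#|Z| + k * L) <= #|V| ->
  #|V| ^ k <= (4 * q) ^ k *
    #|[set s : k.-tuple V | gwalk i v s y && spread B Z s]|.
Proof.
move=> HB; elim: k i v Z => [|k IH] i v Z /=.
  move=> Evy _; rewrite mul1n; apply/card_gt0P; exists [tuple].
  by rewrite inE /= Evy.
move=> Hr HZ.
pose G := [set u | E i v u & rich q y k i.+1 u] :\: Z.
have hG : #|V| <= 4 * q * #|G|.
  have h1 : #|[set u | E i v u & rich q y k i.+1 u]| <= #|G| + #|Z|.
    rewrite -(cardsID Z [set u | E i v u & rich q y k i.+1 u]) addnC leq_add2l.
    by apply: subset_leq_card; apply: subsetIr.
  have h2 := leq_mul (leqnn (2 * q)) h1.
  have h3 : 4 * q * #|Z| <= #|V|.
    by apply: leq_trans HZ; rewrite leq_mul2l leq_addr orbT.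
  move: Hr h2 h3; rewrite -/G; move: #|G| #|Z| #|_| => b c a.
  by move=> *; lia.
have -> : #|[set s : k.+1.-tuple V | gwalk i v s y && spread B Z s]| =
  \sum_u #|[set s : k.-tuple V | (E i v u && gwalk i.+1 u s y) &&
                 ((u \notin Z) && spread B (Z :|: B u) s)]|.
  rewrite -(@card_tuple_cons k (fun u s => (E i v u && gwalk i.+1 u s y) &&
                 ((u \notin Z) && spread B (Z :|: B u) s))).
  by apply: eq_card => -[[|a s] Hs]; rewrite !inE //.
rewrite [in X in _ <= X]expnS -mulnA.
apply: (@leq_trans (4 * q * (#|G| * #|V| ^ k))).
  by rewrite expnS mulnA leq_mul2r hG orbT.
rewrite leq_mul2l; apply/orP; right.
rewrite big_distrr /= [X in _ <= X](bigID (mem G)) /=.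
apply: leq_trans (leq_addr _ _).
rewrite -sum_nat_const; apply: leq_sum => u; rewrite !inE => /andP[uZ /andP[Evu Hu]].
have hZ' : 4 * q * (#|Z :|: B u| + k * L) <= #|V|.
  apply: leq_trans HZ; rewrite leq_mul2l; apply/orP; right.
  have := HB u; have := cardsU Z (B u); rewrite mulSn; lia.
apply: leq_trans (IH _ _ _ Hu hZ') _.
rewrite leq_mul2l; apply/orP; right; apply: subset_leq_card.
by apply/subsetP => s; rewrite !inE Evu uZ.
Qed.

Section Rich.
Variables (q : nat) (y : V).
Hypothesis HE : forall i, expander 9 12 q (E i).

Let R k i := [set v | rich q y k i v].

(** A vertex outside [R k.+1 i] sends fewer than [|V| / (2q)] arcs into [R k i.+1], too few for
    expansion. Hence either the complement of [R k.+1 i] is below [|V| / 12], or [R k.+1 i] exceeds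
    [R k i.+1] by [|V| / q]. *)
Lemma rich_grow k i :
  (11 * #|V| <= 12 * #|R k i|) \/
  (k * #|V| <= q * #|R k i| /\ #|V| <= 12 * #|R k i|).
Proof.
elim: k i => [|k IH] i.
  right; split; first by [].
  have [_ /(_ y) + _] := HE i; rewrite /indeg /R /=; lia.
set S := R k.+1 i; set S' := R k i.+1.
have cS : #|S| + #|~: S| = #|V| by apply: cardsC.
have cut : #|V| <= 12 * #|S'| -> #|V| <= 12 * #|~: S| ->
    q * #|V| <= q * (#|~: S| + #|S'|) + #|V| -> False.
  move=> h1 h2 h3; have [_ _ /(_ _ _ h2 h1 h3)] := HE i.
  rewrite edges_between_suml => h4.
  have h5 : \sum_(x in ~: S) 2 * q * #|[set z in S' | E i x z]|
             <= \sum_(x in ~: S) (#|V|.-1).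
    apply: leq_sum => x; rewrite !inE /= => Hx.
    have -> : [set z in S' | E i x z] = [set u | E i x u & rich q y k i.+1 u].
      by apply/setP => z; rewrite !inE andbC.
    lia.
  rewrite -big_distrr sum_nat_const /= in h5.
  have h6 : 0 < #|V| by apply/card_gt0P; exists y.
  have h7 : #|~: S| <= #|V| := max_card _.
  have h8 := leq_mul h7 (leqnn #|V|.-1).
  move: h4 h5 h6 h8; rewrite -mulnn; move: (\sum_(i in _) _) => c.
  move: #|~: S| #|V| => a b; clear => *; nia.
have [h11|[hk h1]] := IH i.+1; rewrite -/S' in h11 || rewrite -/S' in hk h1.
  have h1 : #|V| <= 12 * #|S'| by lia.
  case: (leqP #|V| (12 * #|~: S|)) => h2; last by left; lia.
  by case: (leqP (q * #|V|) (q * (#|~: S| + #|S'|) + #|V|)) => h3;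
     [case: (cut h1 h2 h3) | nia].
case: (leqP #|V| (12 * #|~: S|)) => h2; last by left; lia.
case: (leqP (q * #|V|) (q * (#|~: S| + #|S'|) + #|V|)) => h3.
  by case: (cut h1 h2 h3).
right; split; nia.
Qed.

(** After [q] gains of [|V| / q] the rich set has at least [11/12] of the vertices, so it meets each
    outneighbourhood, of size at least [|V| / 9], in at least [|V| / 36] vertices; this is where
    [18 <= q] enters. *)
Lemma rich_all k i x : 18 <= q -> q <= k -> rich q y k.+1 i x.
Proof.
move=> hq hk /=; set S := R k i.+1.
have hS : 11 * #|V| <= 12 * #|S|.
  have [//|[h _]] := rich_grow k i.+1; rewrite -/S in h *.
  have : #|S| <= #|V| := max_card _.
  nia.
have -> : [set u | E i x u & rich q y k i.+1 u] = [set w | E i x w] :&: S.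
  by apply/setP => u; rewrite !inE.
have [/(_ x) + _ _] := HE i; rewrite /outdeg => ho.
have := cardsU [set w | E i x w] S.
have : #|[set w | E i x w] :|: S| <= #|V| := max_card _.
have : #|[set w | E i x w] :&: S| <= #|S| by apply: subset_leq_card; apply: subsetIr.
move: ho hS; move: #|_ :&: S| #|_ :|: S| #|S| #|[set w | _]| #|V| => I U c O n.
clear -hq => ho hS h1 h2 h3; apply: (@leq_trans (36 * I)); first by lia.
by apply: leq_mul => //; lia.
Qed.
End Rich.

Lemma walk_count q (B : V -> {set V}) L m x y Z :
  (forall i, expander 9 12 q (E i)) -> 18 <= q -> q < m ->
  (forall u, #|B u| <= L) -> 4 * q * (#|Z| + m * L) <= #|V| ->
  #|V| ^ m <= (4 * q) ^ m *
    #|[set s : m.-tuple V | gwalk 0 x s y && spread B Z s]|.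
Proof.
move=> HE hq hm HB; apply: rich_count => //.
by case: m hm => // m hm; apply: rich_all.
Qed.

Lemma walk_exists q (B : V -> {set V}) L m x y Z :
  (forall i, expander 9 12 q (E i)) -> 18 <= q -> q < m ->
  (forall u, #|B u| <= L) -> 4 * q * (#|Z| + m * L) <= #|V| ->
  exists s : seq V, [/\ size s = m, gwalk 0 x s y & spread B Z s].
Proof.
move=> HE hq hm HB hZ.
have := walk_count x y HE hq hm HB hZ.
have V0 : 0 < #|V| by apply/card_gt0P; exists x.
case: (set_0Vmem [set s : m.-tuple V | gwalk 0 x s y && spread B Z s]) => [->|].
  by rewrite cards0 muln0 leqn0 expn_eq0; lia.
by case=> s; rewrite inE => /andP[? ?] _; exists s; rewrite size_tuple.
Qed.

End Walks.

Lemma spread_set1 (V : finType) (Z : {set V}) s :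
  spread (fun v => [set v]) Z s = uniq s && all (fun v => v \notin Z) s.
Proof.
elim: s Z => //= v s IH Z; rewrite IH.
have -> : all (fun u => u \notin Z :|: [set v]) s =
          (v \notin s) && all (fun u => u \notin Z) s.
  elim: s {IH} => //= u s ->; rewrite !inE !negb_or eq_sym.
  by case: (u \in Z); case: (v == u); case: (v \in s).
by case: (v \in Z); case: (v \in s); case: (uniq s).
Qed.

(** * Greedy choice of disjoint sequences serving every demand *)

Section Greedy.
Variables (V P : finType) (good : P -> pred (seq V)) (m Q J : nat).
Let sp (Z : {set V}) (s : seq V) := spread (fun v => [set v]) Z s.
Hypotheses (V0 : 0 < #|V|) (P0 : 0 < #|P|).
Hypothesis count_good : forall (Z : {set V}) p, #|Z| <= m * J ->
  #|V| ^ m <= Q * #|[set s : m.-tuple V | good p s && sp Z s]|.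

(** Double counting: each [p] is served by a fraction [1/Q] of the [m]-tuples even when [Z] is
    avoided, so some tuple serves a fraction [1/Q] of the total weight. *)
Lemma greedy_step (Z : {set V}) (w : P -> nat) : #|Z| <= m * J ->
  (forall p, 0 < w p) ->
  exists2 s : m.-tuple V, sp Z s && [exists p, good p s] & \sum_p w p <= Q * \sum_(p | good p s) w p.
Proof.
move=> hZ w0; set W := \sum_p w p.
have W0 : 0 < W.
  by case/card_gt0P: P0 => p _; rewrite /W (bigD1 p) //= addn_gt0 w0.
pose served (s : m.-tuple V) := \sum_(p | good p s && sp Z s) w p.
have [/existsP[s /andP[h1 h2]]|/existsPn h] :=
    boolP [exists s : m.-tuple V, sp Z s && (W <= Q * served s)].
  exists s; first (rewrite h1 /=; apply: contraLR h2; rewrite negb_exists -ltnNge).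
    by move=> /forallP h; rewrite /served big_pred0 ?muln0 // => p; rewrite (negPf (h p)).
  apply: leq_trans h2 _; rewrite leq_mul2l; apply/orP; right.
  rewrite /served; under eq_bigl => p do rewrite h1 andbT.
  exact: leqnn.
have : \sum_(s : m.-tuple V) Q * served s <= \sum_(s : m.-tuple V) W.-1.
  apply: leq_sum => s _; have := h s; rewrite negb_and -ltnNge => /orP[hs|]; last lia.
  by rewrite /served (negPf hs) big_pred0 ?muln0 // => p; rewrite andbF.
rewrite sum_nat_const card_tuple -big_distrr /=.
have -> : \sum_(s : m.-tuple V) served s =
          \sum_p w p * #|[set s : m.-tuple V | good p s && sp Z s]|.
  rewrite /served (exchange_big_dep xpredT) //=; apply: eq_bigr => p _.
  by rewrite sum_nat_const mulnC cardsE.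
have h2 : #|V| ^ m * W <= Q * \sum_p w p * #|[set s : m.-tuple V | good p s && sp Z s]|.
  rewrite !big_distrr /=; apply: leq_sum => p _.
  by rewrite mulnC mulnCA leq_mul2l count_good // orbT.
move=> h1; have := leq_trans h2 h1; rewrite leq_mul2l.
have : 0 < #|V| ^ m by rewrite expn_gt0 V0.
lia.
Qed.

(* The exponential weight of [p] halves whenever [p] gains a good sequence, so
   a greedy choice decreases the total weight by a constant factor. *)
Lemma greedy_family_potential j : j <= J ->
  exists F : seq (seq V), [/\ size F = j, all (fun s => (size s == m) && [exists p, good p s]) F,
    uniq (flatten F)
    & Q ^ j * \sum_p 2 ^ (j - count (good p) F) <= (2 * Q - 1) ^ j * #|P|].
Proof.
elim: j => [|j IH] hj.
  exists [::]; split=> //=; rewrite !mul1n.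
  by rewrite -sum1_card; apply: leq_sum => p _; rewrite sub0n.
have [F [hs hm hu hp]] := IH (ltnW hj).
have hcount p : count (good p) F <= j by rewrite -hs count_size.
pose Z := [set v in flatten F].
have hZ : #|Z| <= m * J.
  rewrite cardsE (card_uniqP hu).
  have -> : size (flatten F) = m * size F.
    elim: F hm {hs hu hp hcount Z} => /= [|a F IHF]; first by rewrite muln0.
    move=> /andP[/andP[/eqP ha _] hF].
    by rewrite size_cat IHF // ha mulnS.
  by rewrite hs leq_mul2l (ltnW hj) orbT.
pose w p := 2 ^ (j - count (good p) F).
have w0 p : 0 < w p by rewrite expn_gt0.
have [s] := greedy_step hZ w0.
rewrite /sp spread_set1 => /andP[/andP[us /allP sZ] gs] hw.
exists (val s :: F); split=> /=; first by rewrite hs.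
- by rewrite size_tuple eqxx gs.
- rewrite cat_uniq us hu andbT /=; apply/hasPn => v vF; apply/negP => vs.
  by have := sZ _ vs; rewrite inE vF.
set S := \sum_p w p in hp hw.
(* Weights carry a factor [2 ^ j] to stay integral: unserved ones double and served ones are kept,
   so the total grows by a factor of at most [2 - 1/Q]. *)
have -> : \sum_p 2 ^ (j.+1 - (good p s + count (good p) F)) =
          2 * S - \sum_(p | good p s) w p.
  apply: (@addIn (\sum_(p | good p s) w p)); rewrite subnK; last first.
    rewrite /S [X in _ <= 2 * X](bigID (good^~ s)) /=; lia.
  rewrite /S big_distrr /= [X in X + _](bigID (good^~ s)) /=.
  rewrite addnAC -big_split /= [RHS](bigID (good^~ s)) /=; congr (_ + _).
    by apply: eq_bigr => p ->; rewrite add1n subSS /w addnn -mul2n.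
  apply: eq_bigr => p /negPf ->; rewrite add0n subSn //.
  by rewrite expnS.
have hS : S <= Q * \sum_(p | good p s) w p by [].
rewrite !expnS -!mulnA.
apply: (@leq_trans ((2 * Q - 1) * (Q ^ j * S))); last by rewrite leq_mul2l hp orbT.
rewrite mulnCA [X in _ <= X]mulnCA leq_mul2l; apply/orP; right.
rewrite mulnBr mulnBl mul1n mulnCA mulnA; lia.
Qed.

(** If [p] were served fewer than [M] times, its weight alone would be too large: as
    [(1 - 1/(2Q)) ^ (6Q) <= 1/4], the potential bound would give [4 ^ M <= |P| 2 ^ M]. *)
Lemma greedy_family M : #|P| < 2 ^ M -> J = 6 * Q * M ->
  exists F : seq (seq V), [/\ size F = J, all (fun s => (size s == m) && [exists p, good p s]) F,
    uniq (flatten F) & forall p, M <= count (good p) F].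
Proof.
move=> hP hJ; have [F [hs hm hu hp]] := greedy_family_potential (leqnn J).
exists F; split=> // p; rewrite leqNgt; apply/negP => hlt.
have Q0 : 0 < Q.
  rewrite lt0n; apply/eqP => Qe; have := @count_good set0 p; rewrite cards0 Qe mul0n.
  by move=> /(_ isT); rewrite leqNgt expn_gt0 V0.
have h1 : 2 ^ (J - M) <= \sum_p0 2 ^ (J - count (good p0) F).
  rewrite (bigD1 p) //=; apply: leq_trans (leq_addr _ _).
  by rewrite leq_exp2l //; lia.
have h2 : Q ^ J * 2 ^ (J - M) <= (2 * Q - 1) ^ J * #|P|.
  by apply: leq_trans hp; rewrite leq_mul2l h1 orbT.
have hMJ : M <= J by rewrite hJ leq_pmull // muln_gt0.
have h3 : (2 * Q) ^ J <= (2 * Q - 1) ^ J * (#|P| * 2 ^ M).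
  rewrite expnMn mulnC -[X in 2 ^ X](subnK hMJ) expnD mulnA [_ * (_ * _)]mulnA.
  by rewrite leq_mul2r h2 orbT.
(* Bernoulli's inequality for [(1 + 1/r) ^ h] without denominators; for [r = 2Q - 1] and [h = 6Q]
   the bound [1 + h/r] is at least [4]. *)
have bern r h : (r.+1) ^ h * r >= r ^ h * (r + h).
  elim: h => [|h IHh]; first by rewrite !expn0 addn0.
  rewrite !expnS -!mulnA.
  apply: (@leq_trans (r.+1 * (r ^ h * (r + h)))); last by rewrite leq_mul2l IHh orbT.
  rewrite mulnCA [X in _ <= X]mulnCA leq_mul2l; apply/orP; right; nia.
have h4 : 4 * (2 * Q - 1) ^ (6 * Q) <= (2 * Q) ^ (6 * Q).
  have := bern (2 * Q - 1) (6 * Q).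
  have -> : (2 * Q - 1).+1 = 2 * Q by lia.
  move: (_ ^ _) (_ ^ _) => a b; nia.
have h5 : 4 ^ M * (2 * Q - 1) ^ J <= (2 * Q) ^ J.
  by rewrite hJ 2!(expnM _ (6 * Q) M) -expnMn; case: (M) => // M'; rewrite leq_exp2r.
have h6 : 4 ^ M <= #|P| * 2 ^ M.
  have := leq_trans h5 h3; rewrite [X in _ <= X]mulnC leq_mul2r.
  by rewrite expn_eq0; have -> : (2 * Q - 1 == 0) = false by lia.
move: h6; rewrite (_ : 4 = 2 * 2) // expnMn leq_mul2r expn_eq0 /=.
by rewrite leqNgt hP.
Qed.
End Greedy.

(** * Absorbing paths and the absorbing cycle *)

(** Rearrangements of concatenated lists are checked through the counts of an arbitrary predicate,
    which satisfy linear equations. *)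
Ltac count_lia := rewrite /=; repeat rewrite !count_cat /=; clear;
  repeat (match goal with |- context [@count ?T ?Q ?s] => move: (@count T Q s) => ? end);
  repeat (match goal with |- context [nat_of_bool ?b] => move: (nat_of_bool b) => ? end);
  lia.

Definition flat (V : Type) (ss : seq (V * seq V)) : seq V :=
  flatten [seq t.1 :: t.2 | t <- ss].

Lemma flat_cat (V : Type) (s1 s2 : seq (V * seq V)) :
  flat (s1 ++ s2) = flat s1 ++ flat s2.
Proof. by rewrite /flat map_cat flatten_cat. Qed.

Lemma flat_cons (V : Type) (t : V * seq V) s : flat (t :: s) = (t.1 :: t.2) ++ flat s.
Proof. by []. Qed.

Section Absorb.
Variables (V : finType) (e : rel V).

(** Only the ends of the inserted path matter, so absorbing paths can be built before the paths to
    be absorbed are known. *)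
Definition absorbs (x0 : V) (P0 : seq V) (pr : V * V) : Prop :=
  forall p, path e pr.1 p -> last pr.1 p = pr.2 ->
  exists P', [/\ path e x0 P', last x0 P' = last x0 P0
    & perm_eq (x0 :: P') (x0 :: P0 ++ pr.1 :: p)].

Lemma cycle_replace A B x0 P0 P' :
  cycle e (A ++ (x0 :: P0) ++ B) -> path e x0 P' -> last x0 P' = last x0 P0 ->
  cycle e (A ++ (x0 :: P') ++ B).
Proof.
rewrite -(rot_cycle (size A)) rot_size_cat => hc hp hl.
rewrite -(rot_cycle (size A)) rot_size_cat.
move: hc; rewrite -!catA !cat_cons /= !rcons_cat !cat_path hl hp.
by move=> /andP[_ ->].
Qed.

(** A slot is a path with a set of end pairs that it may absorb; links and slots already used carry
    the empty set. *)
Definition holds (pr : V * V) (t : (V * seq V) * {set V * V}) := pr \in t.2.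

Definition slots_ok (ss : seq ((V * seq V) * {set V * V})) : Prop :=
  forall t, t \in ss -> forall pr, pr \in t.2 -> absorbs t.1.1 t.1.2 pr.

(** Each path uses up one slot holding its pair of ends. This lowers every count by at most one, so
    enough slots remain for the other paths. *)
Lemma absorb_all (ps : seq (V * seq V)) ss :
  slots_ok ss ->
  (forall pr : V * V, size ps <= count (holds pr) ss) ->
  cycle e (flat [seq t.1 | t <- ss]) ->
  all (fun p => path e p.1 p.2) ps ->
  exists2 c, cycle e c & perm_eq c (flat [seq t.1 | t <- ss] ++ flat ps).
Proof.
elim: ps ss => [|[x p] ps IH] ss hok hcount hc /=.
  by move=> _; exists (flat [seq t.1 | t <- ss]) => //; rewrite cats0.
move=> /andP[hp hps]; pose pr := (x, last x p).
have /hasP[t tss prt] : has (holds pr) ss.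
  by rewrite has_count; apply: leq_trans (hcount pr).
have [P' [h1 h2 h3]] := hok _ tss _ prt p hp erefl.
move: tss hok hcount hc => /splitPr[s1 s2] hok hcount hc.
have hin u : u \in s1 ++ s2 -> u \in s1 ++ t :: s2.
  by rewrite !mem_cat inE => /orP[]->; rewrite ?orbT.
have [|pr'|||c cc pc] := IH (s1 ++ ((t.1.1, P'), set0) :: s2).
- move=> u; rewrite mem_cat inE => hu pr' hpr'.
  have [us|us] := boolP (u \in s1 ++ s2); first exact: hok (hin _ us) _ hpr'.
  by move: us hu hpr'; rewrite mem_cat => /norP[/negPf-> /negPf->] /=;
    rewrite orbF => /eqP->; rewrite inE.
- have h0 : holds pr' ((t.1.1, P'), set0) = false by rewrite /holds inE.
  by have := hcount pr'; rewrite !count_cat /= h0; lia.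
- move: hc; rewrite !map_cat !flat_cat /= !flat_cons => hc.
  by apply: (cycle_replace hc).
- by [].
exists c => //; apply: (perm_trans pc).
rewrite !map_cat !flat_cat /= !flat_cons /=; apply/seq.permP => Q.
move/seq.permP: h3 => /(_ Q); rewrite /pr; count_lia.
Qed.

(* [zig a [:: b1; a1; ...; bt; at] x] : the arcs of [e] form the alternating walk
   [a -> b1 <- a1 -> b2 <- a2 ... bt <- at -> x]. *)
Fixpoint zig a s x : bool :=
  match s with
  | b' :: a' :: s' => [&& e a b', e a' b' & zig a' s' x]
  | [::] => e a x
  | _ => false
  end.

Lemma zig_last a s x : zig a s x -> e (last a s) x.
Proof.
elim: {s}(size s) {-2}s (leqnn (size s)) a => [|n IH] [|b [|a' s]] //= hs a.
by case/and3P=> _ _; apply: IH; lia.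
Qed.

Definition alternate (i : nat) : rel V := if odd i then transp e else e.

Lemma gwalk_zig i a s x : ~~ odd i -> ~~ odd (size s) ->
  gwalk alternate i a s x = zig a s x.
Proof.
elim: {s}(size s) {-2}s (leqnn (size s)) a i => [|n IH] [|b [|a' s]] //= hs a i hi;
  rewrite /alternate ?(negPf hi) //= !negbK => os.
by rewrite (negPf hi) /= IH //= ?negbK //; lia.
Qed.

Lemma gwalk_path a s x : gwalk (fun _ => e) 0 a s x = path e a (rcons s x).
Proof. by elim: s 0 a => [|b s IH] i a /=; rewrite ?andbT // IH. Qed.

Section Blocks.
Variables (m kappa : nat).
Hypothesis m0 : 0 < m.
Hypothesis link : forall (Z : {set V}) x y, #|Z| + m <= kappa ->
  exists q, [/\ size q = m, path e x (rcons q y), uniq q & all (fun v => v \notin Z) q].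

(* Invariant: the vertices of a walk [f0 :: full] ending at [b] are split into
   two walks ending at [a] and at [b]; a new pair [(a', b')] extends the one at
   [b] through a link to [a'] and the one at [a] by the arc to [b'], so that
   after two pairs the walks have resumed their roles. *)
Lemma block_extend r s (Z : {set V}) a b f0 full a0 wa b0 wb x :
  size s = 4 * r -> #|Z| + m * (2 * r) <= kappa -> zig a s x ->
  path e f0 full -> last f0 full = b ->
  path e a0 wa -> last a0 wa = a -> path e b0 wb -> last b0 wb = b ->
  perm_eq (f0 :: full) (a0 :: wa ++ b0 :: wb) ->
  exists full' wa' wb' qs,
  [/\ path e f0 full', path e a0 wa', last a0 wa' = last a s,
      path e b0 wb' & last b0 wb' = last f0 full'] /\
  [/\ perm_eq (f0 :: full') (a0 :: wa' ++ b0 :: wb'),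
      perm_eq (f0 :: full') (f0 :: full ++ s ++ qs),
      uniq qs, all (fun v => v \notin Z) qs & size qs = m * (2 * r)].
Proof.
elim: r s Z a b full wa wb => [|r IH] s Z a b full wa wb hs hZ hzig hf lf ha la hb lb hp.
  case: s hs hzig => // _ _; exists full, wa, wb, [::].
  by split; split; rewrite ?cats0 ?muln0 // lb lf.
case: s hs hzig => [|b1 [|a1 [|b2 [|a2 s]]]] //= hs; try (clear -hs; lia).
move=> /and5P[e1 e2 e3 e4 hzig].
have [|q1 [sq1 pq1 uq1 zq1]] := @link Z b a1.
  by apply: leq_trans hZ; rewrite leq_add2l leq_pmulr.
pose Z1 := Z :|: [set v in q1].
have cZ1 : #|Z1| <= #|Z| + m.
  by rewrite -sq1; apply: leq_trans (leq_card_setU _ _) _; rewrite leq_add2l cardsE card_size.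
have [|q2 [sq2 pq2 uq2 zq2]] := @link Z1 b1 a2.
  by apply: leq_trans hZ; clear -cZ1; lia.
pose Z2 := Z1 :|: [set v in q2].
have cZ2 : #|Z2| <= #|Z| + m + m.
  apply: leq_trans (leq_card_setU _ _) _; apply: leq_add => //.
  by rewrite cardsE -sq2 card_size.
(* The full walk takes the arcs [a1 -> b1] and [a2 -> b2]; the two split walks share its links but
   take the crossing arcs [a -> b1] and [a1 -> b2]. *)
pose full2 := full ++ rcons q1 a1 ++ b1 :: rcons q2 a2 ++ [:: b2].
pose wa2 := wa ++ b1 :: rcons q2 a2.
pose wb2 := wb ++ rcons q1 a1 ++ [:: b2].
have [||||||||||full' [wa' [wb' [qs [H1 [H2 H3 H4 H5 H6]]]]]] :=
    IH s Z2 a2 b2 full2 wa2 wb2.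
- by clear -hs; lia.
- by apply: leq_trans hZ; clear -cZ2; lia.
- by [].
- rewrite /full2 !cat_path /= cat_path /= hf lf pq1 !last_rcons /= e2 pq2.
  by rewrite e4.
- by rewrite /full2 !last_cat /= !last_cat.
- by rewrite /wa2 cat_path /= ha la e1 pq2.
- by rewrite /wa2 last_cat /= last_rcons.
- by rewrite /wb2 !cat_path hb lb pq1 last_rcons /= e3.
- by rewrite /wb2 !last_cat.
- rewrite /full2 /wa2 /wb2 -cat_cons; apply/seq.permP => P; move/seq.permP: hp => /(_ P); rewrite -!cats1; count_lia.
exists full', wa', wb', (q1 ++ q2 ++ qs); split; first by rewrite /=.
split=> //.
- apply: (perm_trans H3); apply/seq.permP => P.
  by rewrite /full2 -!cats1; count_lia.
- rewrite !cat_uniq uq1 uq2 H4 andbT /=.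
  have -> /= : ~~ has (mem q1) (q2 ++ qs).
    rewrite has_cat negb_or; apply/andP; split; apply/hasPn => v vq.
      by have := allP zq2 _ vq; rewrite !inE negb_or => /andP[].
    by have := allP H5 _ vq; rewrite !inE !negb_or => /andP[/andP[]].
  by apply/hasPn => v vq; have := allP H5 _ vq; rewrite !inE !negb_or => /andP[/andP[]].
- rewrite !all_cat zq1 /=; apply/andP; split; apply/allP => v vq.
    by have := allP zq2 _ vq; rewrite !inE negb_or => /andP[].
  by have := allP H5 _ vq; rewrite !inE !negb_or => /andP[/andP[]].
- by rewrite !size_cat sq1 sq2 H6; clear; lia.
Qed.

(** The first pair gives the arc [a -> b], split into the walks [[a]] and [[b]]. Once extended, the
    first walk can step to [x], run to [y] and step to [b], where the second begins. Only these two
    steps involve [(x, y)], so one block serves every pair joined by [s]. *)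
Lemma block_exists r s (Z : {set V}) x y :
  size s = 4 * r + 2 -> #|Z| + m * (2 * r) <= kappa -> zig y s x ->
  exists x0 P0 qs, [/\ path e x0 P0, perm_eq (x0 :: P0) (s ++ qs), uniq qs,
     all (fun v => v \notin Z) qs & size qs = m * (2 * r)] /\
     forall pr, zig pr.2 s pr.1 -> absorbs x0 P0 pr.
Proof.
case: s => [|b [|a s]] /= hs hZ; try lia.
move=> /and3P[_ eab hzig].
have hs' : size s = 4 * r by clear -hs; lia.
have pab : path e a [:: b] by rewrite /= eab.
have [full [wa [wb [qs [[H1 H2 H3 H4 H5] [H6 H7 H8 H9 H10]]]]]] :=
  @block_extend r s Z a b a [:: b] a [::] b [::] x hs' hZ hzig pab
    erefl isT erefl isT erefl (perm_refl _).
exists a, full, qs; split.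
  split=> //; apply: (perm_trans H7); apply/seq.permP => P; count_lia.
move=> [x' y'] /= /and3P[ey _ hz] p pp lp /=.
exists (wa ++ x' :: p ++ b :: wb); split.
- rewrite cat_path /= cat_path /= H2 H3 pp H4 lp ey /= andbT.
  exact: zig_last hz.
- by rewrite last_cat /= last_cat.
- by apply/seq.permP => P; move/seq.permP: H6 => /(_ P); count_lia.
Qed.

(** Each block costs [2 * r] inner links and one link leading to it. A link has exactly [m > 0]
    inner vertices, so it is itself stored as a slot. *)
Lemma chain_exists r (F : seq (seq V)) (Z : {set V}) z :
  all (fun s => (size s == 4 * r + 2) && [exists p : V * V, zig p.2 s p.1]) F ->
  #|Z| + m * ((2 * r + 1) * size F) <= kappa ->
  exists ss qs, [/\ path e z (flat [seq t.1 | t <- ss]),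
    perm_eq (flat [seq t.1 | t <- ss]) (flatten F ++ qs), uniq qs,
    all (fun v => v \notin Z) qs & size qs = m * ((2 * r + 1) * size F)] /\
    slots_ok ss /\
    forall pr : V * V, count (holds pr) ss = count (fun s => zig pr.2 s pr.1) F.
Proof.
elim: F Z z => [|s F IH] Z z /=.
  by move=> _ _; exists [::], [::]; split=> //; split=> //=; rewrite !muln0.
move=> /andP[/andP[/eqP hs /existsP[[x y] /= hz]] hF] hZ.
have [|x0 [P0 [q1 [[H1 H2 H3 H4 H5] H6]]]] := @block_exists r s Z x y hs _ hz.
  by apply: leq_trans hZ; rewrite leq_add2l leq_mul2l; apply/orP; right; clear; lia.
pose Z1 := Z :|: [set v in q1].
have cZ1 : #|Z1| <= #|Z| + m * (2 * r).
  by rewrite -H5; apply: leq_trans (leq_card_setU _ _) _; rewrite leq_add2l cardsE card_size.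
have [|q2 [sq2 pq2 uq2 zq2]] := @link Z1 z x0.
  by apply: leq_trans hZ; clear -cZ1; lia.
pose Z2 := Z1 :|: [set v in q2].
have cZ2 : #|Z2| <= #|Z| + m * (2 * r) + m.
  apply: leq_trans (leq_card_setU _ _) _; apply: leq_add => //.
  by rewrite cardsE -sq2 card_size.
have [|ss [qs [[G1 G2 G3 G4 G5] [G6 G7]]]] := IH Z2 (last x0 P0) hF.
  by apply: leq_trans hZ; clear -cZ2; lia.
case: q2 sq2 pq2 uq2 zq2 @Z2 cZ2 G4 => [|u q2]; first by move: m0 => /[swap] <-.
move=> sq2 pq2 uq2 zq2 Z2 cZ2 G4.
exists [:: ((u, q2), set0), ((x0, P0), [set pr | zig pr.2 s pr.1]) & ss],
  (q1 ++ (u :: q2) ++ qs).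
split; last first.
  split; last by move=> pr; rewrite /= /holds /= !inE /= G7.
  move=> t; rewrite !inE => /or3P[/eqP->|/eqP->|]; last exact: G6.
    by move=> pr; rewrite inE.
  by move=> pr; rewrite inE => /H6.
rewrite /= !flat_cons /=; split.
- move: pq2; rewrite /= rcons_path => /andP[-> /andP[pq lq]] /=.
  by rewrite !cat_path /= cat_path pq lq H1 G1.
- apply/seq.permP => Q; move/seq.permP: H2 => /(_ Q); move/seq.permP: G2 => /(_ Q).
  count_lia.
- rewrite (cat_uniq q1) (cat_uniq (u :: q2)) H3 uq2 G3 andbT.
  have -> /= : ~~ has (mem q1) ((u :: q2) ++ qs).
    rewrite has_cat negb_or; apply/andP; split; apply/hasPn => v vq.
      by have := allP zq2 _ vq; rewrite !inE negb_or => /andP[].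
    by have := allP G4 _ vq; rewrite !inE !negb_or => /andP[/andP[]].
  by apply/hasPn => v vq; have := allP G4 _ vq; rewrite !inE !negb_or => /andP[].
- rewrite all_cat H4 andTb -cat_cons all_cat; apply/andP; split; apply/allP => v vq.
    by have := allP zq2 _ vq; rewrite !inE negb_or => /andP[].
  by have := allP G4 _ vq; rewrite !inE !negb_or => /andP[/andP[]].
- rewrite -cat_cons !size_cat H5 G5 sq2; clear; lia.
Qed.

(** A vertex [z] outside the family starts the chain and one more link closes it; these are the
    summands [1] and [m]. *)
Lemma absorbing_cycle_exists r (F : seq (seq V)) :
  all (fun s => (size s == 4 * r + 2) && [exists p : V * V, zig p.2 s p.1]) F ->
  uniq (flatten F) -> size (flatten F) < #|V| ->
  size (flatten F) + 1 + m * ((2 * r + 1) * size F) + m <= kappa ->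
  exists ss, [/\ cycle e (flat [seq t.1 | t <- ss]),
    uniq (flat [seq t.1 | t <- ss]),
    size (flat [seq t.1 | t <- ss]) =
      size (flatten F) + 1 + m * ((2 * r + 1) * size F) + m,
    slots_ok ss &
    forall pr : V * V, count (holds pr) ss = count (fun s => zig pr.2 s pr.1) F].
Proof.
move=> hF uF sF hk.
have [z zF] : exists z, z \notin flatten F.
  apply/existsP; rewrite -negb_forall; apply/negP => /forallP h.
  move: sF; rewrite ltnNge => /negP; apply.
  by rewrite -(card_uniqP uF); apply: subset_leq_card; apply/subsetP => v _; apply: h.
pose Z := z |: [set v in flatten F].
have cZ : #|Z| <= size (flatten F) + 1.
  by rewrite cardsU1 addnC cardsE (card_uniqP uF) leq_add2l leq_b1.
have [|ss [qs [[G1 G2 G3 G4 G5] [G6 G7]]]] := @chain_exists r F Z z hF.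
  by apply: leq_trans hk; clear -cZ; lia.
pose Z2 := Z :|: [set v in qs].
have cZ2 : #|Z2| <= #|Z| + m * ((2 * r + 1) * size F).
  by rewrite -G5; apply: leq_trans (leq_card_setU _ _) _; rewrite leq_add2l cardsE card_size.
have [|q [sq pq uq zq]] := @link Z2 (last z (flat [seq t.1 | t <- ss])) z.
  by apply: leq_trans hk; clear -cZ cZ2; lia.
case: q sq pq uq zq => [|u q]; first by move: m0 => /[swap] <-.
move=> sq pq uq zq.
exists (((z, [::]), set0) :: ss ++ [:: ((u, q), set0)]).
have efl : flat [seq t.1 | t <- ((z, [::]), set0) :: ss ++ [:: ((u, q), set0)]] =
   z :: flat [seq t.1 | t <- ss] ++ u :: q.
  by rewrite /= flat_cons /= map_cat flat_cat /flat /= cats0.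
have pfl : perm_eq (z :: flat [seq t.1 | t <- ss] ++ u :: q)
                   (z :: (flatten F ++ qs) ++ u :: q).
  by rewrite perm_cons perm_cat2r.
rewrite efl; split.
- by rewrite /= rcons_cat cat_path G1.
- have h v : v \in u :: q -> [/\ v != z, v \notin flatten F & v \notin qs].
    by move=> /(allP zq); rewrite !inE !negb_or -andbA => /and3P.
  have h2 v : v \in qs -> v != z /\ v \notin flatten F.
    by move=> /(allP G4); rewrite !inE !negb_or => /andP.
  have z1 : z \notin qs by apply/negP => zi; have [] := h2 _ zi; rewrite eqxx.
  have z2 : z \notin u :: q by apply/negP => zi; have [] := h _ zi; rewrite eqxx.
  have u1 : ~~ has (mem (flatten F)) qs.
    by apply/hasPn => v vq; have [_ h3] := h2 _ vq.
  have u2 : ~~ has (mem (flatten F ++ qs)) (u :: q).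
    apply/hasPn => v vq; have [_ h3 h4] := h _ vq.
    by rewrite /= mem_cat negb_or h3.
  rewrite (perm_uniq pfl) cons_uniq; apply/andP; split.
    by rewrite mem_cat negb_or; apply/andP; split; rewrite // mem_cat negb_or zF z1.
  by rewrite cat_uniq u2 cat_uniq u1 uF G3 uq.
- by rewrite (perm_size pfl) /= !size_cat G5 sq; clear; lia.
- move=> t; rewrite inE mem_cat inE => /or3P[/eqP->|ht|/eqP->] pr.
  + by rewrite inE.
  + exact: G6.
  + by rewrite inE.
- have h0 pr w : holds pr (w, set0) = false by rewrite /holds inE.
  by move=> pr; rewrite -G7 /= count_cat /= !h0 /= !addn0.
Qed.
End Blocks.
End Absorb.

(** * Covering the vertices by few paths *)

Lemma spread_sep (V : finType) (B : V -> {set V}) Z s :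
  (forall u v, (u \in B v) = (v \in B u)) -> (forall v, v \in B v) ->
  spread B Z s ->
  [/\ forall v, v \in s -> v \notin Z, uniq s &
      forall u v, u \in s -> v \in s -> u != v -> v \notin B u].
Proof.
move=> Bsym Brefl; elim: s Z => [|a s IH] Z //= /andP[aZ /IH[h1 h2 h3]].
have h4 v : v \in s -> v \notin Z /\ v \notin B a.
  by move=> /h1; rewrite inE negb_or => /andP.
split.
- by move=> v; rewrite inE => /orP[/eqP->//|/h4[]].
- by rewrite h2 andbT; apply/negP => /h4[_]; rewrite Brefl.
- move=> u v; rewrite !inE => /orP[/eqP->|us] /orP[/eqP->|vs].
  + by rewrite eqxx.
  + by move=> _; have [] := h4 _ vs.
  + by move=> _; rewrite Bsym; have [] := h4 _ us.
  + exact: h3.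
Qed.

Section PathCover.
Variables (V : finType) (e : rel V).
Implicit Types g : {perm V}.

Definition bad g : {set V} := [set x | ~~ e x (g x)].

(** That is, every cycle of [g] has length at least [L]. *)
Definition long L g := forall x j, 0 < j < L -> iter j g x <> x.

Definition near L g v : {set V} :=
  [set iter i g v | i : 'I_L] :|: [set iter i (g^-1)%g v | i : 'I_L].

Lemma iter_permK g i : cancel (iter i g) (iter i (g^-1)%g).
Proof. by elim: i => // i IH u; rewrite iterSr /= permK IH. Qed.

Lemma iter_perm_shift g i u v : iter i g u = v <-> iter i (g^-1)%g v = u.
Proof.
split=> <-; first exact: iter_permK.
by have := iter_permK (g^-1)%g i v; rewrite invgK.
Qed.

Lemma near_sym L g u v : (u \in near L g v) = (v \in near L g u).
Proof.
have h a b : a \in near L g b -> b \in near L g a.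
  rewrite !inE => /orP[] /imsetP[i _ /esym/iter_perm_shift h]; apply/orP.
    by right; apply/imsetP; exists i.
  left; apply/imsetP; exists i => //.
  by move: h; rewrite invgK.
by apply/idP/idP; apply: h.
Qed.

Lemma near_refl L g v : 0 < L -> v \in near L g v.
Proof. by move=> L0; rewrite inE; apply/orP; left; apply/imsetP; exists (Ordinal L0). Qed.

Lemma card_near L g v : #|near L g v| <= 2 * L.
Proof.
apply: leq_trans (leq_card_setU _ _) _; rewrite mul2n -addnn.
by apply: leq_add; apply: leq_trans (leq_imset_card _ _) _; rewrite card_ord.
Qed.

(** A set and its image under [g] have equal size. Rerouting along [s] sends [v] to [g] of the next
    point of [s], so it needs walks in this twisted relation. *)
Lemma expander_perm d k q g : expander d k q e ->
  expander d k q (fun u v => e u (g v)).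
Proof.
have cg (P : pred V) : #|[set w | P (g w)]| = #|[set w | P w]|.
  rewrite -(card_imset _ (@perm_inj _ g)); apply: eq_card => x; rewrite inE.
  apply/imsetP/idP => [[y]|Px]; first by rewrite inE => ? ->.
  by exists ((g^-1)%g x); rewrite ?inE permKV.
move=> [H1 H2 H3]; split.
- by move=> x; rewrite /outdeg (cg (e x)); apply: H1.
- by move=> x; apply: H2.
- move=> S T hS hT hST.
  have -> : edges_between (fun u v => e u (g v)) S T = edges_between e S (g @: T).
    by rewrite !edges_between_sumr big_imset //= => x y _ _; apply: perm_inj.
  by apply: H3; rewrite ?card_imset //; apply: perm_inj.
Qed.

Lemma cyclic_perm_long L : 0 < L <= #|V| -> exists g, long L g.
Proof.
move=> /andP[L0 LV].
have inj : injective (next (enum V)).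
  exact: can_inj (prev_next (enum_uniq V)).
exists (perm inj) => x j /andP[j0 jL].
have -> : iter j (perm inj) x = iter j (next (enum V)) x.
  by apply: eq_iter => y; rewrite permE.
have ho : order (next (enum V)) x = #|V|.
  rewrite cardE; apply: (@order_cycle _ _ (enum V)); rewrite ?mem_enum ?enum_uniq //.
  exact: cycle_next (enum_uniq V).
have hj : j < order (next (enum V)) x by rewrite ho; apply: leq_trans LV.
move=> h; have := orbit_uniq (next (enum V)) x.
move/(uniqP x)/(_ 0 j); rewrite !inE size_orbit order_gt0 hj => /(_ isT isT).
rewrite /orbit !nth_traject //= h => /(_ erefl); lia.
Qed.

Definition reroute g (s : seq V) : V -> V := fun v => g (next s v).

Lemma reroute_inj g s : uniq s -> injective (reroute g s).
Proof. by move=> us x y /perm_inj; apply: can_inj (prev_next us) x y. Qed.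

Lemma next_notin (s : seq V) v : v \notin s -> next s v = v.
Proof. by move=> h; rewrite next_nth (negPf h). Qed.

(* Between two points of [s] the new permutation follows the old one, so a new
   cycle meeting [s] contains a whole stretch of [g] of length at least [L]. *)
Lemma reroute_long L g s (us : uniq s) : long L g ->
  (forall u v, u \in s -> v \in s -> u != v -> v \notin near L g u) ->
  long L (perm (reroute_inj (g := g) us)).
Proof.
move=> hg sep; set g' := perm _.
have g'E v : g' v = g (next s v) by rewrite permE.
have leave p k : p \in s -> 0 < k < L -> iter k g p \notin s.
  move=> ps hk; apply/negP => hs.
  have [h|h] := eqVneq p (iter k g p); first exact: hg (esym h).
  have := sep _ _ ps hs h; rewrite inE negb_or => /andP[/negP + _]; apply.
  by case/andP: hk => _ hk; apply/imsetP; exists (Ordinal hk).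
move=> x j /andP[j0 jL] hx.
have [/existsP[[i hi] /= hs]|/existsPn hn] :=
  boolP [exists i : 'I_j, iter i g' x \in s]; last first.
  have h k : k <= j -> iter k g' x = iter k g x.
    elim: k => //= k IH hk; rewrite -IH ?(ltnW hk) // g'E next_notin //.
    exact: hn (Ordinal hk).
  by apply: (hg x j); rewrite ?j0 // -h.
set p := iter i g' x in hs.
have hp : iter j g' p = p by rewrite /p -iterD addnC iterD hx.
have hp' : next s p \in s by rewrite mem_next.
have h k : 0 < k <= j -> iter k g' p = iter k g (next s p).
  elim: k => //= -[|k] IH hk; first by rewrite /= g'E.
  rewrite IH; last lia.
  rewrite g'E next_notin //; apply: leave => //; lia.
have := leave _ j hp'; rewrite j0 jL => /(_ isT).
by rewrite -h ?j0 ?leqnn // hp hs.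
Qed.

(** Every point of [s] except [y1] receives an arc of [e] from the walk; [y1] was bad before, and
    [y0] is repaired. *)
Lemma reroute_bad g s (us : uniq s) y0 w y1 : s = y0 :: rcons w y1 ->
  y0 \in bad g -> y1 \in bad g -> path (fun u v => e u (g v)) y0 (rcons w y1) ->
  #|bad (perm (reroute_inj (g := g) us))| < #|bad g|.
Proof.
move=> hs b0 b1 hp; apply: proper_card.
have hgood v : v \in s -> v != y1 -> e v (g (next s v)).
  move=> vs /negPf vy.
  suff : e v (g (next s v)) || (v == y1) by rewrite vy orbF.
  apply: (@next_cycle _ (fun u v => e u (g v) || (u == y1)) s) vs.
  rewrite hs /= rcons_path last_rcons eqxx orbT andbT.
  by apply: sub_path hp => a b /= ->.
have y0s : y0 \in s by rewrite hs mem_head.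
have y01 : y0 != y1.
  by move: us; rewrite hs /= mem_rcons inE negb_or => /andP[/andP[]].
apply/properP; split.
  apply/subsetP => v; rewrite inE permE /reroute => hv.
  have [vs|vs] := boolP (v \in s).
    by have [->//|/(hgood _ vs)] := eqVneq v y1; rewrite (negPf hv).
  by rewrite inE; move: hv; rewrite next_notin.
by exists y0; rewrite // inE permE /reroute negbK hgood.
Qed.

Lemma few_bad_perm q m L : expander 9 12 q e -> 18 <= q -> q < m -> 0 < L <= #|V| ->
  4 * q * (4 * L + m * (2 * L)) <= #|V| ->
  exists2 g, long L g & #|bad g| <= 2 * L.
Proof.
move=> he hq hm hL hsz.
have L0 : 0 < L by case/andP: hL.
pose lg g := [forall x, forall j : 'I_L, (0 < j) ==> (iter j g x != x)].
have lgP g : reflect (long L g) (lg g).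
  apply: (iffP forallP) => [h x j /andP[j0 jL] hj|h x].
    by have /forallP/(_ (Ordinal jL)) := h x; rewrite /= j0 hj eqxx.
  apply/forallP => -[j hj]; apply/implyP => /= j0; apply/eqP.
  by apply: h; rewrite j0.
have [g0 /lgP hg0] := cyclic_perm_long hL.
case: (arg_minnP (fun g => #|bad g|) hg0) => g /lgP hg hmin.
exists g => //; rewrite leqNgt; apply/negP => hb.
have /card_gt0P[y0 hy0] : 0 < #|bad g| by apply: leq_trans hb.
(* A window has at most [2 L] points, so among more than [2 L] bad vertices one lies outside the
   window of [y0]. *)
have /subsetPn[y1 hy1 hy01] : ~~ (bad g \subset near L g y0).
  apply: contraL hb => /subset_leq_card h; rewrite -leqNgt.
  exact: leq_trans h (card_near _ _ _).
pose Z := near L g y0 :|: near L g y1.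
have cZ : #|Z| <= 4 * L.
  apply: leq_trans (leq_card_setU _ _) _.
  have := card_near L g y0; have := card_near L g y1; lia.
have [|w [_ hw hsp]] := @walk_exists V (fun _ u v => e u (g v)) q (near L g) (2 * L)
    m y0 y1 Z (fun _ => expander_perm g he) hq hm (card_near L g).
  by apply: leq_trans hsz; rewrite leq_mul2l leq_add2r cZ orbT.
move: hw; rewrite gwalk_path => hw.
have [h1 h2 h3] := spread_sep (near_sym L g) (fun v => near_refl g v L0) hsp.
have far v : v \in w -> v \notin near L g y0 /\ v \notin near L g y1.
  by move=> /h1; rewrite inE negb_or => /andP.
pose s := y0 :: rcons w y1.
have y0w : y0 \notin w by apply/negP => /far[]; rewrite near_refl.
have y1w : y1 \notin w by apply/negP => /far[_]; rewrite near_refl.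
have y10 : y0 != y1 by apply: contraNneq hy01 => <-; rewrite near_refl.
have us : uniq s.
  by rewrite /= mem_rcons inE negb_or y10 y0w rcons_uniq y1w.
have sep u v : u \in s -> v \in s -> u != v -> v \notin near L g u.
  have ms z : z \in s -> [\/ z = y0, z = y1 | z \in w].
    rewrite inE mem_rcons inE => /or3P[/eqP->|/eqP->|zw].
    - exact: Or31.
    - exact: Or32.
    - exact: Or33.
  move=> /ms[->|->|us'] /ms[->|->|vs] uv.
  - by rewrite eqxx in uv.
  - exact: hy01.
  - by case: (far _ vs).
  - by rewrite near_sym.
  - by rewrite eqxx in uv.
  - by case: (far _ vs).
  - by rewrite near_sym; case: (far _ us').
  - by rewrite near_sym; case: (far _ us').
  - exact: h3.
have /lgP /hmin := @reroute_long L g s us hg sep.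
by rewrite leqNgt (@reroute_bad g s us y0 w y1 erefl hy0 hy1 hw).
Qed.

Lemma split_orbit g x p : fpath g x p ->
  exists ps, [/\ all (fun t => path e t.1 t.2) ps, flat ps = x :: p
    & size ps <= (count (mem (bad g)) (x :: p)).+1].
Proof.
elim: p x => [|y p IH] x /=; first by move=> _; exists [:: (x, [::])].
move=> /andP[/eqP gx /IH[[|[a p1] ps] [//= /andP[h1 h2] h3 h4]]].
move: h3; rewrite flat_cons /= => -[ay h3]; rewrite ay in h1.
have [exy|nexy] := boolP (e x y).
  exists ((x, y :: p1) :: ps); split; rewrite /= ?exy ?h1 ?flat_cons /= ?h3 //.
  by apply: leq_trans h4 _; rewrite ltnS leq_addl.
exists ((x, [::]) :: (y, p1) :: ps); split; rewrite /= ?h1 ?flat_cons /= ?h3 //.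
have xb : x \in bad g by rewrite inE gx.
by rewrite xb add1n ltnS.
Qed.

(** There are at most [|V| / L] cycles, and cutting a cycle after its bad vertices gives at most one
    path more than it has bad vertices. The induction removes one cycle at a time from a
    [g]-invariant set. *)
Lemma perm_paths g L : 0 < L -> long L g ->
  exists ps, [/\ all (fun t => path e t.1 t.2) ps, perm_eq (flat ps) (enum V)
    & L * size ps <= #|V| + L * #|bad g|].
Proof.
move=> L0 hg.
suff h (W : {set V}) : (forall x, x \in W -> g x \in W) ->
  exists ps, [/\ all (fun t => path e t.1 t.2) ps, uniq (flat ps), flat ps =i W
    & L * size ps <= #|W| + L * #|bad g :&: W|].
  have [|ps [h1 h2 h3 h4]] := h setT; first by move=> x _; rewrite inE.
  exists ps; split=> //; last by rewrite cardsT setIT in h4.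
  by apply: uniq_perm; rewrite ?enum_uniq // => x; rewrite h3 mem_enum inE.
elim: {W}#|W| {-2}W (leqnn #|W|) => [|k IH] W hW inv.
  move: hW; rewrite leqn0 cards_eq0 => /eqP->; exists [::]; split=> //.
    by move=> x; rewrite inE.
  by rewrite muln0.
have [->|[x xW]] := set_0Vmem W.
  by exists [::]; split=> //; [move=> y; rewrite inE | rewrite muln0].
pose O := orbit g x.
have OW v : v \in O -> v \in W.
  rewrite -fconnect_orbit => /iter_findex <-; elim: (findex _ _ _) => //= j.
  exact: inv.
have cO : size O = order g x by rewrite size_orbit.
have LO : L <= size O.
  rewrite cO leqNgt; apply/negP => hlt; apply: (hg x (order g x)).
    by rewrite order_gt0.
  by apply: iter_order; apply: perm_inj.
pose W' := W :\: [set v in O].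
have eO : O = x :: behead O by rewrite /O /orbit -orderSpred.
have fO : fpath g x (behead O) by rewrite /O /orbit -orderSpred /= fpath_traject.
have cOs : #|[set v in O]| = size O by rewrite cardsE; apply/card_uniqP/orbit_uniq.
have cW : #|W| = #|W'| + size O.
  rewrite -cOs -(cardsID [set v in O] W) addnC; congr (_ + _).
  by apply: eq_card => v; rewrite !inE; case: (boolP (v \in O)) => [/OW->|]; rewrite ?andbF.
have [||ps' [h1 h2 h3 h4]] := IH W'.
- by move: hW; rewrite cW; have := leq_trans L0 LO; clear; lia.
- move=> v; rewrite !inE => /andP[vO vW]; rewrite inv // andbT.
  apply: contra vO; rewrite -!fconnect_orbit.
  by rewrite -(same_fconnect1_r (@perm_inj _ g)).
have [ps [G1 G2 G3]] := split_orbit fO; rewrite -eO in G2 G3.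
exists (ps ++ ps'); split.
- by rewrite all_cat G1.
- rewrite flat_cat cat_uniq h2 G2 orbit_uniq andbT /=.
  by apply/hasPn => v; rewrite h3 !inE => /andP[].
- move=> v; rewrite flat_cat mem_cat G2 h3 !inE.
  by case: (boolP (v \in O)) => [/OW->|].
have cb : count (mem (bad g)) O + #|bad g :&: W'| <= #|bad g :&: W|.
  rewrite -(cardsID [set v in O] (bad g :&: W)); apply: leq_add; last first.
    by apply: subset_leq_card; apply/subsetP => v; rewrite !inE => /and3P[-> -> ->].
  rewrite -size_filter -(card_uniqP (filter_uniq _ (orbit_uniq g x))).
  apply: subset_leq_card; apply/subsetP => v; rewrite mem_filter !inE => /andP[-> vO].
  by rewrite (OW _ vO) vO.
rewrite size_cat; move: h4 G3 cb LO; rewrite cW.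
move: #|W'| (size O) (count _ _) #|_ :&: W'| #|_ :&: W| (size ps) (size ps').
clear => a b c d f n1 n2 h1 h2 h3 h4.
have h5 := leq_mul (leqnn L) h2; have h6 := leq_mul (leqnn L) h3; lia.
Qed.

Lemma few_paths q m L M : expander 9 12 q e -> 18 <= q -> q < m -> 0 < L <= #|V| ->
  4 * q * (4 * L + m * (2 * L)) <= #|V| -> #|V| + 2 * L * L <= L * M ->
  exists ps, [/\ all (fun t => path e t.1 t.2) ps, perm_eq (flat ps) (enum V)
    & size ps <= M].
Proof.
move=> he hq hm hL hsz hM; have [g hg hb] := few_bad_perm he hq hm hL hsz.
have L0 : 0 < L by case/andP: hL.
have [ps [h1 h2 h3]] := perm_paths L0 hg; exists ps; split=> //.
rewrite -(leq_pmul2l L0); apply: leq_trans hM; apply: leq_trans h3 _.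
by rewrite leq_add2l [2 * L * L]mulnC leq_mul2l hb orbT.
Qed.
End PathCover.

(** * Large expanders are hamiltonian *)

Lemma expander_weaken (V : finType) (e : rel V) q : expander 8 16 q e -> expander 9 12 q e.
Proof.
move=> [H1 H2 H3]; split.
- by move=> x; apply: leq_trans (H1 x) _; rewrite leq_mul2r orbT.
- by move=> x; apply: leq_trans (H2 x) _; rewrite leq_mul2r orbT.
- move=> S T hS hT; apply: H3; [move: hS | move: hT]; move=> h;
    by apply: leq_trans h _; rewrite leq_mul2r orbT.
Qed.

(** Here [|U| <= |V| / 64], which lets the degree bound drop only from [1/8] to [1/9]; doubling [q]
    pays for the at most [|V| / (2q)] missing vertices. *)
Lemma expander_sub (V : finType) (e : rel V) q (U : {set V}) :
  expander 8 16 q e -> 32 <= q -> 2 * q * #|U| <= #|V| ->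
  expander 9 12 (2 * q) (fun x y : {v : V | v \notin U} => e (val x) (val y)).
Proof.
move=> [H1 H2 H3] hq hU; pose V' : predArgType := {v : V | v \notin U}; rewrite -[{v : V | _}]/V'.
have cV : #|V'| + #|U| = #|V|.
  rewrite card_sig -(cardsC U) addnC; congr (_ + _).
  by apply: eq_card => v; rewrite !inE.
have h64 : 64 * #|U| <= #|V| by apply: leq_trans hU; rewrite leq_mul2r; lia.
have deg (P : pred V) : #|V| <= 8 * #|[set w | P w]| ->
    #|V'| <= 9 * #|[set w : V' | P (val w)]|.
  have -> : #|[set w : V' | P (val w)]| = #|[set w | P w] :\: U|.
    rewrite -(card_imset _ val_inj); apply: eq_card => v; rewrite !inE.
    apply/imsetP/andP => [[w]|[vU Pv]]; first by rewrite inE => Pw ->; rewrite (valP w).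
    by exists (exist _ v vU : V'); rewrite ?inE.
  have : #|[set w | P w]| <= #|[set w | P w] :\: U| + #|U|.
    by rewrite -(cardsID U) addnC leq_add2l subset_leq_card // subsetIr.
  move: cV h64; move: #|V'| #|U| #|V| #|_ :\: U| #|[set w | P w]|; clear; lia.
split.
- by move=> x; apply: deg (H1 (val x)).
- by move=> x; apply: deg (H2 (val x)).
- move=> S T hS hT hST.
  have -> : edges_between (fun x y : V' => e (val x) (val y)) S T =
            edges_between e (val @: S) (val @: T).
    rewrite !edges_between_suml big_imset /=; last by move=> x y _ _; apply: val_inj.
    apply: eq_bigr => x _; rewrite -(card_imset _ val_inj); apply: eq_card => v.
    rewrite !inE; apply/imsetP/andP => [[y]|[/imsetP[y yT ->] h]].
      by rewrite !inE => /andP[yT h] ->; rewrite imset_f.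
    by exists y; rewrite // !inE yT.
  have cS : #|val @: S| = #|S| by apply: card_imset; apply: val_inj.
  have cT : #|val @: T| = #|T| by apply: card_imset; apply: val_inj.
  have {}hS : #|V'| <= 12 * #|S| := hS.
  have {}hT : #|V'| <= 12 * #|T| := hT.
  have {}hST : 2 * q * #|V'| <= 2 * q * (#|S| + #|T|) + #|V'| := hST.
  have h1 : #|V| <= 16 * #|val @: S|.
    by rewrite cS; move: cV h64 hS; clear; lia.
  have h2 : #|V| <= 16 * #|val @: T|.
    by rewrite cT; move: cV h64 hT; clear; lia.
  have h3 : q * #|V| <= q * (#|val @: S| + #|val @: T|) + #|V|.
    rewrite cS cT; move: cV hU hST.
    move: #|V'| #|U| #|V| #|S| #|T| => a u n s t; clear => <- hU h.
    lia.
  apply: leq_trans (leq_trans (H3 _ _ h1 h2 h3) _).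
    by rewrite leq_sqr -cV leq_addr.
  by rewrite leq_mul2r leq_pmull ?orbT.
Qed.

(** [2 ^ M] is at least the cube of [2 ^ (M %/ 3)], and a cubic beats a quadratic. This will bound
    the number of vertex pairs by [2 ^ M] with [M] proportional to [|V|]. *)
Lemma exp2_gt_square D : exists M0, forall M, M0 <= M -> (D * M.+1) ^ 2 < 2 ^ M.
Proof.
exists (27 * D ^ 2) => M hM; set y := M %/ 3.
have hy : M = y * 3 + M %% 3 := divn_eq M 3.
have h3 : M %% 3 < 3 by rewrite ltn_mod.
have h4 : y < 2 ^ y by apply: ltn_expl.
have h5 : (2 ^ y) ^ 3 <= 2 ^ M by rewrite -expnM leq_exp2l //; lia.
apply: leq_trans h5; apply: (@leq_trans (y.+1 ^ 3)); last by rewrite leq_exp2r.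
apply: (@leq_ltn_trans ((9 * D ^ 2) * y.+1 ^ 2)).
  rewrite expnMn [9 * _]mulnC -mulnA leq_mul2l; apply/orP; right.
  rewrite -(expnMn 3 y.+1 2) leq_sqr; lia.
rewrite (expnS y.+1 2) ltn_mul2r expn_gt0 /=; lia.
Qed.

Theorem expander_hamiltonian q : 32 <= q -> exists n0 : nat,
  forall (V : finType) (e : rel V), n0 <= #|V| -> expander 8 16 q e -> hamiltonian e.
Proof.
move=> hq.
(* [m] exceeds [q] and gives alternating walks of [2 q + 1] pairs, an odd number. Constants enter
   through equations so that large powers stay opaque. *)
have [m mE] : {m | m = 4 * q + 2} by eexists.
have [Q QE] : {Q | Q = (4 * q) ^ m} by eexists.
(* An absorbing cycle with [M] slots for every pair has [C * M + m + 1] vertices; [D] keeps this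
   below [|V| / (4q)] for [M = |V| %/ D]. *)
have [C CE] : {C | C = 6 * Q * (m * (2 * q + 2))} by eexists.
have [D DE] : {D | D = 4 * q * (C + m + 1)} by eexists.
have Q0 : 0 < Q by rewrite QE expn_gt0; lia.
have D0 : 0 < D by rewrite DE !muln_gt0 addn1 andbT; lia.
have [M0 hM0] := exp2_gt_square D.
(* The summands provide for the exponential bound, the number of covering paths and the room for
   rerouting. *)
have [K KE] : {K | K = M0 + (8 * D + 1) + 32 * q * (4 + 2 * m)} by eexists.
have K1 : 0 < K by rewrite KE addnAC addnA addn1.
exists (D * K) => V e hV he.
have [M ME] : {M | M = #|V| %/ D} by eexists.
have [kappa kE] : {kappa | kappa = #|V| %/ (4 * q)} by eexists.
have hMK : K <= M by rewrite ME leq_divRL // mulnC.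
have hDM : D * M <= #|V| by rewrite ME mulnC leq_divM.
have hDM1 : #|V| < D * M.+1 by rewrite ME mulnC ltn_ceil.
have hk : 4 * q * kappa <= #|V| by rewrite kE mulnC leq_divM.
have CMk : C * M + m + 1 <= kappa.
  have M1 : 1 <= M by apply: leq_trans hMK.
  rewrite kE leq_divRL; last by rewrite muln_gt0; clear -hq; lia.
  apply: leq_trans hDM; rewrite DE mulnC -[X in _ <= X]mulnA leq_mul2l.
  apply/orP; right; rewrite !mulnDl mul1n.
  by apply: leq_add => //; rewrite leq_add2l leq_pmulr.
have V0 : 0 < #|V| by apply: leq_trans hV; rewrite muln_gt0 D0.
have he' := expander_weaken he.
have halt i : expander 9 12 q (alternate e i).
  by rewrite /alternate; case: odd => //; apply: expander_transp.
have hq18 : 18 <= q by apply: leq_trans hq.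
have hqm : q < m by rewrite mE; clear -hq; lia.
have [J JE] : {J | J = 6 * Q * M} by eexists.
have hJ : m * J + 1 + m * ((2 * q + 1) * J) + m = C * M + m + 1.
  by rewrite JE CE; clear; lia.
pose good (p : V * V) (s : seq V) := zig e p.2 s p.1.
have hcount (Z : {set V}) (p : V * V) : #|Z| <= m * J ->
  #|V| ^ m <= Q * #|[set s : m.-tuple V | good p s && spread (fun v => [set v]) Z s]|.
  move=> hZ.
  have := @walk_count V (alternate e) q (fun v => [set v]) 1 m p.2 p.1 Z halt hq18 hqm.
  have -> : [set s : m.-tuple V | gwalk (alternate e) 0 p.2 s p.1 &&
               spread (fun v => [set v]) Z s] =
            [set s : m.-tuple V | good p s && spread (fun v => [set v]) Z s].
    apply/setP => s; rewrite !inE gwalk_zig // size_tuple mE; clear; lia.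
  rewrite QE; apply; [by move=> u; rewrite cards1|].
  apply: leq_trans hk; rewrite leq_mul2l; apply/orP; right.
  apply: leq_trans CMk; rewrite -hJ muln1; move: hZ; clear; lia.
have P0 : 0 < #|{: V * V}| by rewrite card_prod muln_gt0 V0.
have hP : #|{: V * V}| < 2 ^ M.
  rewrite card_prod mulnn; apply: leq_ltn_trans (hM0 M _); first by rewrite leq_sqr ltnW.
  by apply: leq_trans hMK; rewrite KE -addnA leq_addr.
have [F [sF aF uF cF]] := greedy_family V0 P0 hcount hP JE.
have szF : size (flatten F) = m * J.
  rewrite -sF; elim: F {sF uF cF} aF => [|s F IH] /=; first by rewrite muln0.
  by move=> /andP[/andP[/eqP hs _] /IH hF]; rewrite size_cat hF hs mulnS.
have link (Z : {set V}) x y : #|Z| + m <= kappa -> exists t : seq V,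
  [/\ size t = m, path e x (rcons t y), uniq t & all (fun v => v \notin Z) t].
  move=> hZ.
  have [||t [st]] := @walk_exists V (fun _ => e) q (fun v => [set v]) 1 m x y Z
    (fun _ => he') hq18 hqm.
  - by move=> u; rewrite cards1.
  - by apply: leq_trans hk; rewrite muln1 leq_mul2l hZ orbT.
  by rewrite gwalk_path spread_set1 => pt /andP[ut zt]; exists t.
have m0 : 0 < m by rewrite mE addn2.
have aF' : all (fun s => (size s == 4 * q + 2) && [exists p : V * V, zig e p.2 s p.1]) F.
  by rewrite -mE.
have kV : kappa < #|V|.
  apply: leq_trans hk; have : 0 < kappa by apply: leq_trans CMk; rewrite addn1.
  by clear -hq; nia.
have [||ss [cS uS sS okS hS]] := @absorbing_cycle_exists V e m kappa m0 link q F aF' uF.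
- by apply: leq_trans kV; rewrite ltnS; apply: leq_trans CMk; rewrite -hJ szF -!addnA leq_addr.
- by rewrite szF sF hJ.
set fs := flat _ in cS uS sS.
pose U := [set v in fs].
have cU : #|U| <= kappa.
  by rewrite cardsE (card_uniqP uS) sS szF sF hJ.
have hU : 2 * q * #|U| <= #|V|.
  by apply: leq_trans hk; apply: leq_mul => //; rewrite leq_mul2r orbT.
pose V' : predArgType := {v : V | v \notin U}.
have cV : #|V'| + #|U| = #|V|.
  rewrite card_sig -(cardsC U) addnC; congr (_ + _).
  by apply: eq_card => v; rewrite !inE.
have hV' : #|V| <= 2 * #|V'|.
  have h64 : 2 * #|U| <= #|V| by apply: leq_trans hU; rewrite leq_mul2r; clear -hq; lia.
  by move: cV h64; clear; lia.
(* With [L = 2 D] there are at most about [M / 2] cycles, which leaves the rest of [M] for the [2 L]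
   bad vertices. *)
have [L LE] : {L | L = 2 * D} by eexists.
have hKV : D * (8 * D + 1) + D * (32 * q * (4 + 2 * m)) <= #|V|.
  by apply: leq_trans hV; rewrite -mulnDr leq_mul2l KE; apply/orP; right; clear; lia.
have [||||||ps [pP pE pS]] := @few_paths V' (fun x y => e (val x) (val y)) (2 * q) m L M.
- exact: expander_sub.
- by clear -hq; lia.
- by rewrite mE; clear -hq; lia.
- apply/andP; split; first by rewrite LE muln_gt0.
  rewrite -(leq_pmul2l (isT : 0 < 2)); apply: leq_trans hV'; apply: leq_trans hKV.
  apply: leq_trans (leq_addr _ _); rewrite LE mulnDr muln1 mulnCA.
  by clear -D0; nia.
- rewrite -(leq_pmul2l (isT : 0 < 2)); apply: leq_trans hV'; apply: leq_trans hKV.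
  apply: leq_trans (leq_addl _ _); rewrite LE; clear; lia.
- have h1 : #|V'| <= #|V| by rewrite -cV leq_addr.
  have h2 : 8 * D + 1 <= M.
    by apply: leq_trans hMK; rewrite KE addnAC leq_addl.
  have h3 := leq_mul (leqnn D) h2.
  by move: h1 h3 hDM1; rewrite LE; move: #|V'| #|V|; clear; move=> a b; nia.
pose ps' := [seq (val t.1, [seq val v | v <- t.2]) | t <- ps].
have fE : flat ps' = [seq val v | v <- flat ps].
  rewrite /flat map_flatten; congr flatten; rewrite /ps' -!map_comp.
  exact: eq_map.
have [pr|||c cc pc] := @absorb_all V e ps' ss okS.
- rewrite size_map; apply: leq_trans pS _.
  by rewrite hS; apply: (cF pr).
- exact: cS.
- rewrite /ps' all_map; apply/allP => t tp /=; rewrite path_map.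
  exact: (allP pP).
have pc' : perm_eq c (fs ++ flat ps') by [].
have mem v : v \in c.
  rewrite (perm_mem pc') mem_cat fE.
  have [|vU] := boolP (v \in U); first by rewrite inE => ->.
  apply/orP; right; apply/mapP; exists (exist _ v vU : V') => //.
  by rewrite (perm_mem pE) mem_enum.
exists c; split => //.
- by apply/eqP => ce; case/card_gt0P: V0 => v _; have := mem v; rewrite ce.
- rewrite (perm_uniq pc') cat_uniq uS fE (map_inj_uniq val_inj) (perm_uniq pE).
  rewrite enum_uniq andbT /=; apply/hasPn => v /mapP[w _ ->].
  by have := valP w; rewrite inE.
Qed.

(** * Stability of the densities *)

Local Open Scope ring_scope.

Lemma ler_of_scaled (R : realFieldType) (x y z t u : R) :
  0 < x -> x * y <= x * z + t -> t <= x * u -> y <= z + u.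
Proof. by move=> x0 h1 h2; rewrite -(ler_pM2l x0) mulrDr; lra. Qed.

(* [a b c d] are the densities of [S :\: T], the complement of [S :|: T],
   [T :\: S] and [S :&: T], and [xy] is the density of the arcs from [x] to [y];
   the last four hypotheses average the Ore condition over pairs of parts. *)
Lemma density_stability (R : realFieldType) (w v a b c d aa ab bc cc cd da bd db : R) :
  0 < w -> w <= 1 / 100 -> 0 < v -> 1000 * (100 * v) <= w * w * w ->
  0 <= a -> 0 <= b -> 0 <= c -> 0 <= d -> a + b + c + d = 1 ->
  1 / 16 <= a + d -> 1 / 16 <= c + d -> b <= d + v ->
  0 <= aa -> 0 <= ab -> 0 <= bc -> 0 <= cc -> 0 <= cd -> 0 <= da -> 0 <= bd -> 0 <= db ->
  aa <= a * a / 2 -> ab <= a * b -> bc <= b * c -> cc <= c * c / 2 ->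
  cd <= c * d -> da <= a * d -> bd + db <= b * d ->
  3 / 4 * (a * c) <= c * (aa + ab) + a * (bc + cc) + 3 * v ->
  3 / 4 * (a * d) <= d * (aa + ab) + a * (bd + cd) + 3 * v ->
  3 / 4 * (d * c) <= c * (da + db) + d * (bc + cc) + 3 * v ->
  3 / 4 * (d * d) <= d * (da + db) + d * (bd + cd) + 3 * v ->
  (`|b - 1 / 4| <= 10 * w /\ `|d - 1 / 4| <= 10 * w /\ `|a + c - 1 / 2| <= 10 * w) /\
  (a * b - 10 * w < ab /\ b * c - 10 * w < bc /\ c * d - 10 * w < cd /\
   a * d - 10 * w < da) /\
  (a / 8 - 10 * w < bd /\ c / 8 - 10 * w < db /\
   a * a / 2 - 10 * w < aa /\ c * c / 2 - 10 * w < cc).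
Proof.
move=> w0 w1 v0 hv a0 b0 c0 d0 hsum had hcd hbd aa0 ab0 bc0 cc0 cd0 da0 bd0 db0
  uaa uab ubc ucc ucd uda ubd hAC hAD hDC hDD.
have p1 : da + db <= a * d + b * d by clear -uda ubd bd0; lra.
have p2 : bc + cc <= b * c + c * c / 2 by clear -ubc ucc; lra.
have p3 : aa + ab <= a * a / 2 + a * b by clear -uaa uab; lra.
have p4 : bd + cd <= b * d + c * d by clear -ucd ubd db0; lra.
have p5 : da + db + (bd + cd) <= a * d + b * d + c * d by clear -uda ubd ucd; lra.
have hAC' : a * c * (3 / 4) <= a * c * ((a + c) / 2 + 2 * b) + 3 * v.
  by move: hAC (ler_wpM2l c0 p3) (ler_wpM2l a0 p2); clear=> *; lra.
have hDC' : d * c * (3 / 4) <= d * c * (a + 2 * b + c / 2) + 3 * v.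
  by move: hDC (ler_wpM2l c0 p1) (ler_wpM2l d0 p2); clear=> *; lra.
have hAD' : a * d * (3 / 4) <= a * d * (c + 2 * b + a / 2) + 3 * v.
  by move: hAD (ler_wpM2l d0 p3) (ler_wpM2l a0 p4); clear=> *; lra.
have dE : a * d + b * d + c * d = d * (1 - d) by rewrite -hsum; ring.
have w0' := ltW w0.
have ww : w * w <= w / 100 by move: (ler_wpM2l w0' w1); clear=> *; lra.
have www : w * w * w <= w / 100 / 100.
  by move: (ler_wpM2r w0' ww) (ww); clear=> *; lra.
have v3 : 3 * v <= w * w * w by move: hv v0; clear=> *; lra.
have v1 : v <= w / 1000 / 1000 / 1000 by move: hv www; clear=> *; lra.
(* A smaller [d] would make [b] small too and bound [a], [c] below; then the condition on the pair
   of parts [(A, C)] has right side near [1/2], short of [3/4]. *)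
have d32 : 1 / 32 <= d.
  rewrite leNgt; apply/negP => hd.
  have a32 : 1 / 32 <= a by clear -hd had; lra.
  have c32 : 1 / 32 <= c by clear -hd hcd; lra.
  have ac : (1 / 32) * (1 / 32) <= a * c by apply: ler_pM => //; clear; lra.
  have ac1 : 0 < a * c by apply: lt_le_trans ac; clear; lra.
  have ht : 3 * v <= a * c * (1 / 16) by clear -ac v1 w1; lra.
  have := ler_of_scaled ac1 hAC' ht.
  by clear -hd hbd hsum b0 d0 v1 w1 => *; lra.
have d1 : 0 < d by clear -d32; lra.
have hDD2 : d * (3 / 4 * d) <= d * (da + db + (bd + cd)) + 3 * v.
  by clear -hDD; lra.
(* Arcs between [D] and its complement have density at most [d (1 - d)], so the condition on
   [(D, D)] reads [3/4 <= 1 - d] up to an error. *)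
have hd2 : d <= 1 / 4 + w / 100.
  have dd : (1 / 32) * (1 / 32) <= d * d by apply: ler_pM => //; clear; lra.
  have dd0 : 0 < d * d by rewrite mulr_gt0.
  have h1 : d * d * d <= d * d * (1 / 4) + 3 * v.
    by rewrite dE in p5; move: hDD2 (ler_wpM2l d0 p5); clear=> *; lra.
  have h2 : 3 * v <= d * d * (w / 100).
    have w100 : 0 <= w / 100 by clear -w0; lra.
    by move: (ler_wpM2r w100 dd) v1 w0; clear=> *; lra.
  exact: ler_of_scaled dd0 h1 h2.
(* For [a], [c] at least [w] this is the condition on [(A, C)] divided by [a c]; if one of them is
   smaller, [D] takes its place. *)
have key : 3 / 4 <= (a + c) / 2 + 2 * b + 2 * w.
  have [aw|aw] := ltP a w.
    have c4 : 1 / 4 <= c by clear -aw hsum hbd hd2 v1 w1 w0; lra.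
    have dc : (1 / 32) * (1 / 4) <= d * c by apply: ler_pM => //; clear; lra.
    have dc0 : 0 < d * c by apply: lt_le_trans dc; clear; lra.
    have ht : 3 * v <= d * c * w by move: (ler_wpM2r w0' dc) v1 w0; clear=> *; lra.
    by have := ler_of_scaled dc0 hDC' ht; clear -aw w0 => *; lra.
  have [cw|cw] := ltP c w.
    have a4 : 1 / 4 <= a by clear -cw hsum hbd hd2 v1 w1 w0; lra.
    have dc : (1 / 4) * (1 / 32) <= a * d by apply: ler_pM => //; clear; lra.
    have dc0 : 0 < a * d by apply: lt_le_trans dc; clear; lra.
    have ht : 3 * v <= a * d * w by move: (ler_wpM2r w0' dc) v1 w0; clear=> *; lra.
    by have := ler_of_scaled dc0 hAD' ht; clear -cw w0 => *; lra.
  have ac : w * w <= a * c by apply: ler_pM.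
  have ac0 : 0 < a * c by apply: lt_le_trans ac; rewrite mulr_gt0.
  have ht : 3 * v <= a * c * w.
    by apply: le_trans v3 _; rewrite ler_wpM2r.
  by have := ler_of_scaled ac0 hAC' ht; clear -w0 => *; lra.
(* As the densities sum to [1], [key] reads [1/4 - 2 w <= 3 b / 2 - d / 2], which with [b <= d + v]
   bounds [d] below. *)
have d_lo : 1 / 4 - 3 * w <= d by clear -key hsum hbd v1 w0; lra.
have b_lo : 1 / 4 - 3 * w <= b by clear -key hsum hd2 d_lo w0; lra.
have b_hi : b <= 1 / 4 + w by clear -hbd hd2 v1 w0; lra.
have up : (a + c) / 2 + 2 * b <= 3 / 4 + w by clear -hsum hbd hd2 v1 w0; lra.
have a1 : a <= 1 by clear -hsum b0 c0 d0; lra.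
have b1 : b <= 1 by clear -hsum a0 c0 d0; lra.
have c1 : c <= 1 by clear -hsum a0 b0 d0; lra.
have d2 : d <= 1 by clear -hsum a0 b0 c0; lra.
have scale_v x : w <= x -> 3 * v <= x * w.
  move=> wx; have ww0 : 0 <= w * w by exact: mulr_ge0.
  by move: (ler_wpM2r w0' wx) (ler_wpM2l ww0 w1) v3 (ww0); clear=> *; lra.
have defD : a * d + b * d + c * d - (da + db + (bd + cd)) <= 3 * w.
  have ht : 3 * v <= d * (96 * v).
    have v96 : 0 <= 96 * v by clear -v0; lra.
    by move: (ler_wpM2r v96 d32); clear=> *; lra.
  have h1 := ler_of_scaled d1 hDD2 ht.
  have h2 : d * (1 / 4 - d) <= d * (3 * w).
    by apply: ler_wpM2l => //; clear -d_lo; lra.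
  have h3 : d * (3 * w) <= (1 / 2) * (3 * w).
    by apply: ler_wpM2r; [clear -w0; lra | clear -hd2 w1; lra].
  by rewrite dE; clear -h1 h2 h3 v1 w0; lra.
have small x y z t : 0 <= y <= 1 -> w <= x -> 0 <= z -> 0 <= t ->
    x * z + x * t <= x * (y * (6 * w)) + 3 * v -> z <= 7 * w /\ t <= 7 * w.
  move=> /andP[y0 y1] wx z0 t0; rewrite -mulrDr => h.
  have x0 : 0 < x by apply: lt_le_trans wx.
  have h1 := ler_of_scaled x0 h (scale_v x wx).
  have w6 : 0 <= 6 * w by clear -w0; lra.
  have h2 := ler_wpM2r w6 y1.
  by split; clear -h1 h2 z0 t0 w0; lra.
have sq01 x : 0 <= x -> x <= 1 -> x < w -> x * x / 2 <= w /\ 0 <= x * x.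
  move=> x0 x1 xw; split; last exact: mulr_ge0.
  by move: (ler_wpM2l x0 x1) xw (x0); clear=> *; lra.
have wd : w <= d by clear -d32 w1; lra.
have ea : 0 <= a * a / 2 - aa by clear -uaa; lra.
have eb : 0 <= a * b - ab by clear -uab; lra.
have ec : 0 <= c * c / 2 - cc by clear -ucc; lra.
have ed : 0 <= b * c - bc by clear -ubc; lra.
have a01 : 0 <= a <= 1 by rewrite a0.
have c01 : 0 <= c <= 1 by rewrite c0.
(* The condition on [(A, C)] is now nearly tight, so the weighted deficits of the arc densities are
   small; [small] divides by the weights. *)
have defAC : c * (a * a / 2 - aa) + c * (a * b - ab) +
             (a * (c * c / 2 - cc) + a * (b * c - bc)) <= a * c * w + 3 * v.
  have ac0 : 0 <= a * c by exact: mulr_ge0.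
  by move: hAC (ler_wpM2l ac0 up); clear=> *; lra.
have acw : 0 <= a * c * w by rewrite !mulr_ge0.
have [eaa eab] : a * a / 2 - aa <= 7 * w /\ a * b - ab <= 7 * w.
  have [aw|aw] := ltP a w.
    have [h1 h2] := sq01 a a0 a1 aw.
    by split; [|move: (ler_wpM2l a0 b1)]; clear -h1 aa0 ab0 aw w0 => *; lra.
  have [cw|cw] := ltP c w.
    apply: (small d a) => //.
    have h : c + 2 * b + a / 2 <= 3 / 4 + 6 * w by clear -up cw w0; lra.
    have ad0 : 0 <= a * d by exact: mulr_ge0.
    by move: hAD (ler_wpM2l a0 p4) (ler_wpM2l ad0 h); clear=> *; lra.
  apply: (small c a) => //.
  by move: defAC acw (mulr_ge0 a0 ec) (mulr_ge0 a0 ed); clear=> *; lra.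
have [ecc ebc] : c * c / 2 - cc <= 7 * w /\ b * c - bc <= 7 * w.
  have [cw|cw] := ltP c w.
    have [h1 h2] := sq01 c c0 c1 cw.
    by split; [|move: (ler_wpM2r c0 b1)]; clear -h1 cc0 bc0 cw w0 => *; lra.
  have [aw|aw] := ltP a w.
    apply: (small d c) => //.
    have h : a + 2 * b + c / 2 <= 3 / 4 + 6 * w by clear -up aw w0; lra.
    have ad0 : 0 <= d * c by exact: mulr_ge0.
    by move: hDC (ler_wpM2l c0 p1) (ler_wpM2l ad0 h); clear=> *; lra.
  apply: (small a c) => //.
  by move: defAC acw (mulr_ge0 c0 ea) (mulr_ge0 c0 eb); clear=> *; lra.
have dlo1 : - (3 * w) <= d * (d - 1 / 4).
  have h1 : d * (- (3 * w)) <= d * (d - 1 / 4).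
    by apply: ler_wpM2l => //; clear -d_lo; lra.
  by move: h1 (ler_wpM2r w0' d2); clear=> *; lra.
have dlo2 x : 0 <= x -> x <= 1 -> x / 4 - 3 * w <= d * x.
  by move=> x0 x1; move: (ler_wpM2r x0 d_lo) (ler_wpM2r w0' x1); clear=> *; lra.
(* In the condition on [(A, D)], with [b], [d] near [1/4] and [a + c] near [1/2], the share left for
   [bd] is [3/16 - a/8 - 1/16 - c/4], about [a/8]. *)
have ebd : a / 8 - 10 * w < bd.
  have [aw|aw] := ltP a w; first by clear -aw bd0 w0; lra.
  have h1 : a * (3 / 4 * d) <= a * (d * (a / 2 + b) + bd + c * d) + 3 * v.
    by move: hAD (ler_wpM2l d0 p3) (ler_wpM2l a0 ucd); clear=> *; lra.
  have := ler_of_scaled (lt_le_trans w0 aw) h1 (scale_v a aw).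
  by move: (dlo2 a a0 a1) dlo1 dE w0; clear=> *; lra.
have edb : c / 8 - 10 * w < db.
  have [cw|cw] := ltP c w; first by clear -cw db0 w0; lra.
  have h1 : c * (3 / 4 * d) <= c * (d * (c / 2 + b) + db + a * d) + 3 * v.
    by move: hDC (ler_wpM2l d0 p2) (ler_wpM2l c0 uda); clear=> *; lra.
  have := ler_of_scaled (lt_le_trans w0 cw) h1 (scale_v c cw).
  by move: (dlo2 c c0 c1) dlo1 dE w0; clear=> *; lra.
split.
  rewrite !ler_norml; split; [|split]; apply/andP; split;
    by clear -d_lo b_lo b_hi hd2 hsum w0; lra.
split; first by do !split; clear -eab ebc defD uda ucd ubd w0; lra.
by do !split => //; clear -eaa ecc w0; lra.
Qed.

(** * Consequences of the Ore condition *)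

Section Counting.
Local Open Scope nat_scope.
Variables (V : finType) (e : rel V).
Implicit Types X Y : {set V}.

Lemma oriented_pairs X Y : oriented_graph e ->
  edges_between e X Y + edges_between e Y X <= #|X| * #|Y|.
Proof.
move=> [irr anti]; rewrite (edges_between_suml e X Y) (edges_between_sumr e Y X).
rewrite -big_split -sum_nat_const /=; apply: leq_sum => x _.
have dis : [set y in Y | e x y] :&: [set y in Y | e y x] = set0.
  apply/setP => y; rewrite !inE; apply/negP => /andP[/andP[_ h1] /andP[_ h2]].
  have [xy|/anti] := eqVneq x y; first by rewrite xy irr in h1.
  by rewrite h1 h2.
rewrite -cardsUI dis cards0 addn0; apply: subset_leq_card.
by apply/subsetP => y; rewrite !inE => /orP[] /andP[].
Qed.

Lemma edges_between_setUr X Y1 Y2 : [disjoint Y1 & Y2] ->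
  edges_between e X (Y1 :|: Y2) = edges_between e X Y1 + edges_between e X Y2.
Proof. by move=> h; rewrite !edges_between_sumr -bigU //; apply: eq_bigl => x; rewrite !inE. Qed.

Lemma edges_between_setUl X Y1 Y2 : [disjoint Y1 & Y2] ->
  edges_between e (Y1 :|: Y2) X = edges_between e Y1 X + edges_between e Y2 X.
Proof. by move=> h; rewrite !edges_between_suml -bigU //; apply: eq_bigl => x; rewrite !inE. Qed.

Lemma edges_from X : edges_between e X setT = \sum_(x in X) outdeg e x.
Proof.
rewrite edges_between_suml; apply: eq_bigr => x _.
by apply: eq_card => y; rewrite !inE.
Qed.

Lemma edges_to Y : edges_between e setT Y = \sum_(y in Y) indeg e y.
Proof.
rewrite edges_between_sumr; apply: eq_bigr => x _.
by apply: eq_card => y; rewrite !inE.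
Qed.

Definition ore_condition := forall x y : V, x != y -> ~~ e x y ->
  3 * #|V| <= 4 * (outdeg e x + indeg e y) + 3.

(** Otherwise about [7/8] of the vertices are not outneighbours of [x] and have indegree about
    [5/8 |V|] or more; but [35/64] exceeds the density [1/2] possible in an oriented graph. *)
Lemma ore_outdeg x : oriented_graph e -> ore_condition -> 28 <= #|V| ->
  #|V| <= 8 * outdeg e x.
Proof.
move=> hor hore hN; rewrite leqNgt; apply/negP => hd.
set d := outdeg e x in hd.
pose Y := ~: (x |: [set w | e x w]).
have cY : #|V| <= #|Y| + d + 1.
  have := cardsC (x |: [set w | e x w]); rewrite cardsU1 -/Y -/d.
  have : (x \notin [set w | e x w]) <= 1 by apply: leq_b1.
  rewrite /d /outdeg; move: #|Y| #|_| #|_| (nat_of_bool _) => *; lia.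
have h1 : \sum_(y in Y) 3 * #|V| <= \sum_(y in Y) (4 * d + 3 + 4 * indeg e y).
  apply: leq_sum => y; rewrite !inE negb_or => /andP[yx nexy].
  have := hore x y; rewrite eq_sym yx => /(_ isT nexy); rewrite -/d.
  by move: (indeg _ _) => i; clear; lia.
have hs : \sum_(y in Y) (4 * d + 3 + 4 * indeg e y) =
    #|Y| * (4 * d + 3) + 4 * edges_between e setT Y.
  by rewrite edges_to big_split /= sum_nat_const big_distrr.
rewrite hs sum_nat_const in h1.
have h2 : edges_between e setT Y <= edges_between e setT setT.
  rewrite !edges_to [X in _ <= X](bigID (mem Y)) /=.
  by under [X in _ <= X + _]eq_bigl => i do rewrite inE /=; apply: leq_addr.
have h3 := oriented_pairs setT setT hor; rewrite cardsT in h3.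
clear hs; move: h1 h2 h3 cY hd hN; move: #|Y| #|V| d (edges_between _ _ _) (edges_between _ _ _).
clear; move=> y n d E1 E2 h1 h2 h3 cY hd hN.
have h4 : y * (3 * n) <= y * (4 * d + 3) + 2 * (n * n) by lia.
have h5 : 7 * n <= 8 * y + 7 by lia.
have h6 : y * (5 * n) <= 4 * (n * n) + y * 5.
  have := leq_mul (leqnn y) (_ : 8 * d + 1 <= n); lia.
have [k nk] : exists k, n = k + 1 by exists n.-1; lia.
have h7 : 7 * k * (5 * k) <= 8 * y * (5 * k) by apply: leq_mul; lia.
subst n; nia.
Qed.

(** The condition is summed over [X] times [Y]; a term [3 |V|] pays for each arc and each diagonal
    pair, where it does not apply. *)
Lemma ore_sum X Y : ore_condition ->
  3 * #|V| * (#|X| * #|Y|) <=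
  4 * (#|Y| * edges_between e X setT + #|X| * edges_between e setT Y) +
  6 * #|V| ^ 2 + 3 * #|V| * edges_between e X Y.
Proof.
move=> hore.
have h1 : \sum_(x in X) \sum_(y in Y) 3 * #|V| <=
    \sum_(x in X) \sum_(y in Y) (4 * outdeg e x + 4 * indeg e y + 3 +
      3 * #|V| * e x y + 3 * #|V| * (x == y)).
  apply: leq_sum => x _; apply: leq_sum => y _.
  have [exy|nexy] := boolP (e x y); first by clear; lia.
  have [xy|xy] := eqVneq x y; first by clear; lia.
  have := hore _ _ xy nexy; clear; lia.
have h2 : \sum_(x in X) \sum_(y in Y) (4 * outdeg e x + 4 * indeg e y + 3 +
      3 * #|V| * e x y + 3 * #|V| * (x == y)) =
    4 * (#|Y| * edges_between e X setT + #|X| * edges_between e setT Y) +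
    3 * (#|X| * #|Y|) + 3 * #|V| * edges_between e X Y + 3 * #|V| * #|X :&: Y|.
  rewrite edges_from edges_to edges_between_suml.
  have -> : #|X :&: Y| = \sum_(x in X) \sum_(y in Y) (x == y).
    rewrite -sum1_card (eq_bigl (fun x => (x \in X) && (x \in Y))); last first.
      by move=> x; rewrite inE.
    rewrite big_mkcondr /=; apply: eq_bigr => x _.
    have [xY|xY] := boolP (x \in Y).
      rewrite (bigD1 x) //= eqxx big1 ?addn0 // => y /andP[_ /negPf].
      by rewrite eq_sym => ->.
    by rewrite big1 // => y yY; case: eqP => // xy; rewrite xy yY in xY.
  have -> : \sum_(x in X) #|[set y in Y | e x y]| = \sum_(x in X) \sum_(y in Y) e x y.
    apply: eq_bigr => x _; rewrite -sum1dep_card big_mkcondr /=.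
    by apply: eq_bigr => y _; case: (e x y).
  under eq_bigr => x _ do rewrite !big_split /= -!big_distrr /= !sum_nat_const.
  rewrite !big_split /= -!big_distrr /= !sum_nat_const; clear; lia.
rewrite h2 in h1; apply: leq_trans (leq_trans _ h1) _.
  under eq_bigr => x _ do rewrite sum_nat_const.
  by rewrite sum_nat_const; clear; lia.
have h3 : #|X| * #|Y| <= #|V| * #|V| by apply: leq_mul; apply: max_card.
have h4 : #|V| * #|X :&: Y| <= #|V| * #|V| by rewrite leq_mul2l max_card orbT.
rewrite -mulnn; move: h3 h4.
move: (#|V| * #|V|) (#|X| * #|Y|) (edges_between _ _ _) (#|Y| * _) (#|X| * _).
clear => *; lia.
Qed.

End Counting.

Lemma oriented_transp (V : finType) (e : rel V) :
  oriented_graph e -> oriented_graph (transp e).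
Proof. by move=> [h1 h2]; split=> // x y xy; rewrite /transp andbC; apply: h2. Qed.

Lemma ore_indeg (V : finType) (e : rel V) x : oriented_graph e -> ore_condition e ->
  (28 <= #|V|)%N -> (#|V| <= 8 * indeg e x)%N.
Proof.
move=> /oriented_transp hor hore; apply: (@ore_outdeg V (transp e) x hor).
by move=> y z yz nyz; rewrite [(outdeg _ _ + _)%N]addnC; apply: hore => //; rewrite eq_sym.
Qed.

(** * From failed expansion to the extremal structure *)

Local Open Scope ring_scope.

(** After division by [4 n ^ 3] the quadratic error costs at most [v / 4] and the arcs between the
    two sets at most [3 v / 4]. *)
Lemma ore_density (R : realFieldType) (n x y o i eo v : R) : 0 < n -> 6 <= v * n -> eo <= v ->
  3 * n * ((x * n) * (y * n)) <=
    4 * ((y * n) * (o * n ^+ 2) + (x * n) * (i * n ^+ 2)) + 6 * n ^+ 2 + 3 * n * (eo * n ^+ 2) ->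
  3 / 4 * (x * y) <= y * o + x * i + v.
Proof.
move=> n0 hv he h.
have n2 : 0 < n * n by rewrite mulr_gt0.
have n3 : 0 < 4 * (n * n * n) by rewrite !mulr_gt0.
rewrite -(ler_pM2l n3).
have h1 : n * n * 6 <= n * n * (v * n) by rewrite ler_pM2l.
have h2 : n * n * n * eo <= n * n * n * v by rewrite ler_pM2l // mulr_gt0.
by move: h h1 h2; rewrite !expr2; clear=> *; lra.
Qed.

Lemma extremal_of_not_expander (R : realType) (K eta : R) : 0 < K * eta ->
  exists2 q : nat, (32 <= q)%N & exists n0 : nat,
  forall (V : finType) (e : rel V), (n0 <= #|V|)%N -> oriented_graph e ->
    ore_condition e -> expander 8 16 q e \/ extremal K eta e.
Proof.
move=> eps0.
pose w := Num.min (1 / 100) (K * eta / 20).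
have w0 : 0 < w by rewrite lt_min; apply/andP; split; [|move: eps0]; lra.
have w1 : w <= 1 / 100 by rewrite ge_min lexx.
have weps : 10 * w <= K * eta.
  have : w <= K * eta / 20 by rewrite ge_min lexx orbT.
  by move: eps0; clear; lra.
(* Conditions will be divided by products as small as [w ^ 2] and must leave an error of order [w],
   hence the cube. *)
have [v [v0 hv]] : exists v : R, 0 < v /\ 1000 * (100 * v) <= w * w * w.
  exists (w * w * w / 1000 / 100); split; last by lra.
  by rewrite !divr_gt0 // !mulr_gt0.
have [q0 hq0] : exists q0 : nat, v^-1 < q0%:R.
  exists (Num.bound v^-1); have := archi_boundP (ltW (_ : 0 < v^-1)).
  by rewrite invr_gt0 => /(_ v0).
pose q := (q0 + 32)%N; exists q; first exact: leq_addl.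
have qv : 1 <= q%:R * v.
  have : v^-1 <= q%:R by rewrite natrD; apply: ler_wpDr => //; apply: ltW.
  by move=> /(ler_wpM2r (ltW v0)); rewrite mulVf // gt_eqF.
have q32 : (32 <= q)%N by exact: leq_addl.
clearbody q.
exists (6 * q)%N => V e hN hor hore.
have N28 : (28 <= #|V|)%N by apply: leq_trans hN; clear -q32; lia.
have [/existsP[S /existsP[T /and4P[hS hT hST hlt]]]|hno] :=
  boolP [exists S : {set V}, exists T : {set V},
   [&& (#|V| <= 16 * #|S|)%N, (#|V| <= 16 * #|T|)%N,
     (q * #|V| <= q * (#|S| + #|T|) + #|V|)%N & (q * edges_between e S T < #|V| ^ 2)%N]];
  last first.
  left; split; [by move=> x; apply: ore_outdeg|by move=> x; apply: ore_indeg|].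
  move=> S T hS hT hST; rewrite leqNgt; apply: contra hno => h.
  by apply/existsP; exists S; apply/existsP; exists T; rewrite hS hT hST h.
right.
(* Few arcs from [S] to [T] means few from [A] to [C] and few inside [D], as extremality asks. *)
pose A := S :\: T; pose D := S :&: T; pose C := T :\: S; pose B := ~: (S :|: T).
have SE : S = A :|: D by apply/setP => x; rewrite !inE; case: (x \in S); case: (x \in T).
have TE : T = C :|: D by apply/setP => x; rewrite !inE; case: (x \in S); case: (x \in T).
have fullE : setT = (A :|: B) :|: (C :|: D).
  by apply/setP => x; rewrite !inE; case: (x \in S); case: (x \in T).
have dis (X Y : {set V}) : (forall x, ~~ ((x \in X) && (x \in Y))) -> [disjoint X & Y].
  by move=> h; rewrite -setI_eq0; apply/eqP/setP => x; rewrite !inE; apply/negbTE.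
have AB : [disjoint A & B] by apply: dis => x; rewrite !inE; case: (x \in S); case: (x \in T).
have AC : [disjoint A & C] by apply: dis => x; rewrite !inE; case: (x \in S); case: (x \in T).
have AD : [disjoint A & D] by apply: dis => x; rewrite !inE; case: (x \in S); case: (x \in T).
have BC : [disjoint B & C] by apply: dis => x; rewrite !inE; case: (x \in S); case: (x \in T).
have BD : [disjoint B & D] by apply: dis => x; rewrite !inE; case: (x \in S); case: (x \in T).
have CD : [disjoint C & D] by apply: dis => x; rewrite !inE; case: (x \in S); case: (x \in T).
have ABCD : [disjoint A :|: B & C :|: D].
  by apply: dis => x; rewrite !inE; case: (x \in S); case: (x \in T).
have cU (X Y : {set V}) : [disjoint X & Y] -> #|X :|: Y| = (#|X| + #|Y|)%N.
  by move=> h; rewrite cardsU (disjoint_setI0 h) cards0 subn0.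
have cN : (#|A| + #|B| + #|C| + #|D|)%N = #|V|.
  by rewrite -cardsT fullE !cU // addnA.
have cS : #|S| = (#|A| + #|D|)%N by rewrite {1}SE cU.
have cT : #|T| = (#|C| + #|D|)%N by rewrite {1}TE cU.
have outE (X : {set V}) : edges_between e X setT =
   (edges_between e X A + edges_between e X B + edges_between e X C + edges_between e X D)%N.
  by rewrite fullE !edges_between_setUr // addnA.
have inE' (X : {set V}) : edges_between e setT X =
   (edges_between e A X + edges_between e B X + edges_between e C X + edges_between e D X)%N.
  by rewrite fullE !edges_between_setUl // addnA.
have eST : edges_between e S T =
   (edges_between e A C + edges_between e A D + edges_between e D C + edges_between e D D)%N.
  by rewrite SE TE edges_between_setUl // !edges_between_setUr // !addnA.
clearbody A B C D.
pose n : R := #|V|%:R.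
have n0 : 0 < n by rewrite ltr0n; apply: leq_trans N28.
have n2 : 0 < n ^+ 2 by rewrite exprn_gt0.
pose p (X : {set V}) : R := #|X|%:R / n.
pose r (X Y : {set V}) : R := (edges_between e X Y)%:R / n ^+ 2.
have pE (X : {set V}) : #|X|%:R = p X * n by rewrite /p divfK // gt_eqF.
have rE (X Y : {set V}) : (edges_between e X Y)%:R = r X Y * n ^+ 2 by rewrite /r divfK // gt_eqF.
have p0 (X : {set V}) : 0 <= p X by rewrite divr_ge0 // ltW.
have r0 (X Y : {set V}) : 0 <= r X Y by rewrite divr_ge0 // ltW.
have nE : #|V|%:R = n by [].
clearbody p r.
have pair (X Y : {set V}) : r X Y + r Y X <= p X * p Y.
  have := oriented_pairs X Y hor; rewrite -(ler_nat R) natrD natrM !rE !pE.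
  move=> h; rewrite -(ler_pM2r n2); move: h; rewrite !expr2; clear=> *; lra.
have vn : 6 <= v * n.
  have : 6 * (q%:R : R) <= n by rewrite -natrM ler_nat.
  move=> /(ler_wpM2l (ltW v0)); apply: le_trans.
  by move: qv; clear; lra.
have hr : r A C + r A D + r D C + r D D < v.
  have qr : 0 < q%:R :> R by rewrite ltr0n; apply: leq_trans q32.
  have h : q%:R * (r A C + r A D + r D C + r D D) < 1.
    move: hlt; rewrite eST -(ltr_nat R) natrM natrX !natrD !rE nE.
    by move=> h; rewrite -(ltr_pM2r n2); move: h; rewrite mul1r; clear=> *; lra.
  rewrite -(ltr_pM2l qr); apply: lt_le_trans h qv.
have sum1 : p A + p B + p C + p D = 1.
  apply: (mulIf (lt0r_neq0 n0)).
  move: cN => /(congr1 (fun k => k%:R : R)); rewrite !natrD !pE nE => h.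
  by rewrite !mulrDl mul1r.
have ore (X Y : {set V}) : r X Y <= v ->
    3 / 4 * (p X * p Y) <= p Y * (r X A + r X B + r X C + r X D) +
                           p X * (r A Y + r B Y + r C Y + r D Y) + v.
  move=> h; apply: (ore_density n0 vn h).
  have := ore_sum X Y hore; rewrite -(ler_nat R) outE inE'.
  rewrite !(natrM, natrD, natrX) !rE !pE nE.
  by clear; lra.
have h16 (X : {set V}) : (#|V| <= 16 * #|X|)%N -> 1 / 16 <= p X.
  rewrite -(ler_nat R) natrM pE nE => h; rewrite -(ler_pM2r n0).
  by move: h; clear; lra.
have pS : p S = p A + p D.
  by apply: (mulIf (lt0r_neq0 n0)); rewrite -pE cS natrD !pE; ring.
have pT : p T = p C + p D.
  by apply: (mulIf (lt0r_neq0 n0)); rewrite -pE cT natrD !pE; ring.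
have bd : p B <= p D + v.
  have qr : 0 < q%:R :> R by rewrite ltr0n; apply: leq_trans q32.
  have h : q%:R * (p A + p B + p C + p D) <= q%:R * (p S + p T) + 1.
    rewrite sum1 mulr1 -(ler_pM2r n0).
    by move: hST; rewrite -(ler_nat R) !(natrM, natrD) !pE nE; clear=> *; lra.
  have : q%:R * (p A + p B + p C + p D) <= q%:R * (p S + p T + v).
    by move: h qv; clear=> *; lra.
  by rewrite ler_pM2l // pS pT; clear=> *; lra.
have p1 (X : {set V}) : p X <= 1.
  by rewrite -(ler_pM2r n0) mul1r -pE ler_nat max_card.
have pv (X : {set V}) s : 0 <= s -> s <= v -> p X * s <= v.
  by move=> s0; apply: le_trans; apply: ler_piMl.
have [uAC uAD uCC uDD] : [/\ r A C + r A D <= v, r D C + r D D <= v,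
    r A C + r D C <= v & r A D + r D D <= v].
  by move: hr (r0 A C) (r0 A D) (r0 D C) (r0 D D); clear=> *; split; lra.
have [rAC rAD rDC rDD] : [/\ r A C < v, r A D < v, r D C < v & r D D < v].
  by move: hr (r0 A C) (r0 A D) (r0 D C) (r0 D D); clear=> *; split; lra.
have h16S := h16 S hS; have h16T := h16 T hT; rewrite pS in h16S; rewrite pT in h16T.
have gAC := pv C _ (addr_ge0 (r0 A C) (r0 A D)) uAC.
have gAD := pv D _ (addr_ge0 (r0 A C) (r0 A D)) uAC.
have gDC := pv C _ (addr_ge0 (r0 D C) (r0 D D)) uAD.
have gDD := pv D _ (addr_ge0 (r0 D C) (r0 D D)) uAD.
have kAC := pv A _ (addr_ge0 (r0 A C) (r0 D C)) uCC.
have kDC := pv D _ (addr_ge0 (r0 A C) (r0 D C)) uCC.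
have kAD := pv A _ (addr_ge0 (r0 A D) (r0 D D)) uDD.
have kDD := pv D _ (addr_ge0 (r0 A D) (r0 D D)) uDD.
(* One [v] comes from averaging, the other two from discarding arcs that run from [S] to [T]. *)
have hAC : 3 / 4 * (p A * p C) <=
    p C * (r A A + r A B) + p A * (r B C + r C C) + 3 * v.
  by move: (ore A C (ltW rAC)) gAC kAC; clear=> *; lra.
have hAD : 3 / 4 * (p A * p D) <=
    p D * (r A A + r A B) + p A * (r B D + r C D) + 3 * v.
  by move: (ore A D (ltW rAD)) gAD kAD; clear=> *; lra.
have hDC : 3 / 4 * (p D * p C) <=
    p C * (r D A + r D B) + p D * (r B C + r C C) + 3 * v.
  by move: (ore D C (ltW rDC)) gDC kDC; clear=> *; lra.
have hDD : 3 / 4 * (p D * p D) <=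
    p D * (r D A + r D B) + p D * (r B D + r C D) + 3 * v.
  by move: (ore D D (ltW rDD)) gDD kDD; clear=> *; lra.
have within X : r X X <= p X * p X / 2 by move: (pair X X); clear=> *; lra.
have between X Y : r X Y <= p X * p Y by move: (pair X Y) (r0 Y X); clear=> *; lra.
have uDA : r D A <= p A * p D by rewrite mulrC.
have v_eps : v < K * eta.
  have w2 : 0 <= w * w by rewrite mulr_ge0 // ltW.
  move: hv weps (ler_wpM2l w2 w1) (ler_wpM2l (ltW w0) w1) (w0) v0.
  by clear=> *; lra.
have [[eB [eD eAC]] [[eAB [eBC [eCD eDA]]] [eBD [eDB [eA eC]]]]] :=
  density_stability w0 w1 v0 hv (p0 A) (p0 B) (p0 C) (p0 D) sum1 h16S h16T bd
    (r0 A A) (r0 A B) (r0 B C) (r0 C C) (r0 C D) (r0 D A) (r0 B D) (r0 D B)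
    (within A) (between A B) (between B C) (within C) (between C D) uDA
    (pair B D) hAC hAD hDC hDD.
have lower x y : x - 10 * w < y -> x * n ^+ 2 - K * eta * n ^+ 2 < y * n ^+ 2.
  move=> h; rewrite -mulrBl ltr_pM2r //.
  by apply: le_lt_trans h; rewrite lerD2l lerN2.
have dist x y : `|x - 1 / y| <= 10 * w -> `|x * n - n / y| <= K * eta * n.
  move=> h; rewrite [n / y]mulrC -[y^-1]mul1r -mulrBl normrM (gtr0_norm n0) ler_pM2r //.
  exact: le_trans h weps.
have upper x : x < v -> x * n ^+ 2 < K * eta * n ^+ 2.
  by move=> h; rewrite ltr_pM2r //; apply: lt_trans h v_eps.
have sqE X Y : p X * n * (p Y * n) = p X * p Y * n ^+ 2 by rewrite expr2; ring.
have eighth X : p X * n * n / 8 = p X / 8 * n ^+ 2 by rewrite expr2; ring.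
have half X : (p X * n) ^+ 2 / 2 = p X * p X / 2 * n ^+ 2 by rewrite !expr2; ring.
exists A, B, C, D; split; rewrite ?(pE, rE, nE) ?(sqE, eighth, half) //;
  try (by apply: lower); try (by apply: upper).
- by have := dist _ _ eAC; rewrite mulrDl.
- by have := dist _ _ eB.
- by have := dist _ _ eD.
Qed.

Local Open Scope ring_scope.

Theorem theorem1p5 (R : realType) (K : R) (hK : 0 < K) :
  exists eta0 : R, 0 < eta0 /\
    forall eta : R, 0 < eta -> eta <= eta0 ->
    exists n0 : nat, forall n : nat, (n0 <= n)%N ->
    forall (V : finType) (e : rel V),
      #|V| = n ->
      oriented_graph e ->
      (forall x y : V, x != y -> ~~ e x y ->
         (outdeg e x + indeg e y)%:R >= (3 * n%:R - 3) / 4 :> R) ->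
      hamiltonian e \/ extremal K eta e.
Proof.
exists 1; split=> // eta eta_gt0 _.
have [q q32 [n1 h1]] := extremal_of_not_expander (mulr_gt0 hK eta_gt0).
have [n2 h2] := expander_hamiltonian q32.
exists (maxn n1 n2) => n; rewrite geq_max => /andP[le1 le2] V e Vn orient ore.
rewrite -Vn in le1 le2 ore.
have ore_nat : ore_condition e.
  move=> x y xy nxy; have := ore x y xy nxy.
  by rewrite -(ler_nat R) !(natrD, natrM); lra.
have [expa|] := h1 V e le1 orient ore_nat; last by right.
by left; apply: h2.
Qed.
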